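(* Assume conditions A.1)–A.8) listed in the context. Let $(\hat\theta,\hat\gamma)=\arg\min_{\theta\in\Theta,\gamma\in\Gamma}Q_G(\theta,\gamma)$ be the GEE estimator. Then $\hat\theta$ is consistent: $\nu(\hat\theta,\theta^0)\to_p 0$ as $G\to\infty$.
   Context: **Lattice, NED, mixing.** $D\subseteq\mathbb R^d$, $d\ge1$, carries the metric $\rho(i,j)=\max_{1\le l\le d}|j_l-i_l|$; for $U,V\subseteq D$, $\rho(U,V)=\inf\{\rho(i,j):i\in U,j\in V\}$; $|U|$ is cardinality. $D_n\subseteq T_n\subseteq D$ are finite with $|D_n|=n\to\infty$. All fields are triangular arrays on a probability space (index $n$ often suppressed). $\|X\|_p=(E|X|^p)^{1/p}$, $\|X\|=\|X\|_2$. A field $Z=\{Z_{n,i}\}$ is $L_p$-near-epoch dependent (NED) on $\varepsilon=\{\varepsilon_{n,i}\}$ with constants $d_{n,i}>0$ and coefficients $\varphi(s)\ge0$, $\varphi(s)\to0$, if $\|Z_{n,i}-E(Z_{n,i}|\mathcal F_{n,i}(s))\|_p<d_{n,i}\varphi(s)$, where $\mathcal F_{n,i}(s)=\sigma(\varepsilon_{n,j}:\rho(i,j)\le s)$; uniformly NED if also $\sup_n\sup_i d_{n,i}<\infty$. The mixing coefficients of $\varepsilon$ are $\overline\alpha(u,v,h)=\sup_n\sup\{\alpha(\sigma(\varepsilon_{n,i},i\in U),\sigma(\varepsilon_{n,i},i\in V)):|U|\le u,|V|\le v,\rho(U,V)\ge h\}$, with $\alpha(\mathscr A,\mathscr B)=\sup\{|P(A\cap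 B)-P(A)P(B)|:A\in\mathscr A,B\in\mathscr B\}$. **Model and groups.** One observes $(\mathbf x_i,y_i)$, $i\in D_n$. $D_n$ is the disjoint union of groups $B_1,\dots,B_G$, each of fixed size $L$; $D_G$ denotes the set of groups, $|D_G|=G$. $\mathbf x_g$ ($L\times p$) and $\mathbf y_g$ ($L\times1$) collect the data of group $g$. Group distance: $\rho(g,h)=\min_{i\in B_g,j\in B_h}\rho(i,j)$. The parameters are $\theta\in\Theta\subset\mathbb R^p$, $\gamma\in\Gamma\subset\mathbb R^q$. The mean is correctly specified: $E(\mathbf y_g|\mathbf x_g)=\mathbf m_g(\mathbf x_g;\theta^0)=:\mathbf m_g(\theta^0)$. $\mathbf W_g(\theta,\gamma)$ is an $L\times L$ parametrized working (possibly misspecified) conditional covariance matrix of $\mathbf y_g$ given $\mathbf x_g$. $\nabla\mathbf m_g(\theta)$ is the $L\times p$ gradient. Define $q_g(\theta,\gamma)=(\mathbf y_g-\mathbf m_g(\theta))^\top\mathbf W_g^{-1}(\theta,\gamma)(\mathbf y_g-\mathbf m_g(\theta))$, $Q_G(\theta,\gamma)=(M_GG)^{-1}\sum_gq_g(\theta,\gamma)$ ($M_G$ in A.5), $s_g(\theta,\gamma)=\nabla\mathbf m_g^\top(\theta)\mathbf W_g^{-1}(\theta,\gamma)(\mathbf y_g-\mathbf m_g(\theta))$, $\mathbf S_G=(M_GG)^{-1}\sum_gs_g$, $h_g(\theta,\gamma)=-\nabla\mathbf m_g^\top\mathbf W_g^{-1}\nabla\mathbf m_g+[(\mathbf y_g-\mathbf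 m_g)^\top\mathbf W_g^{-1}\otimes I_p]\,\partial\mathrm{Vec}(\nabla\mathbf m_g^\top)/\partial\theta+[(\mathbf y_g-\mathbf m_g)^\top\otimes\nabla\mathbf m_g^\top]\,\partial\mathrm{Vec}(\mathbf W_g^{-1})/\partial\theta$ (the $p\times p$ Hessian contribution). $\overline Q_G=E\,Q_G$, $Q_\infty=\lim_G\overline Q_G$, $\mathbf S_\infty=\lim_GE\,\mathbf S_G$; the true parameter is $(\theta^0,\gamma^0)=\arg\min Q_\infty=\mathrm{argzero}\,\mathbf S_\infty$ over $\Theta\times\Gamma$. Asymptotics are $G\to\infty$, $L$ fixed. **Assumptions.** A.1) $D$ is countably infinite, and $\rho(i,j)\ge\rho_0$ for all $i\ne j$ in $D$, where $\rho_0>1$. A.2) $\{y_i\}$ is uniformly $L_4$-NED on the $\alpha$-mixing field $\varepsilon=\{\varepsilon_i\}$, $\varepsilon_i=(\mathbf x_i,\epsilon_i)$ ($\epsilon_i$ underlying innovations), with constants $d_{n,i}$, $\sup_{n,i}d_{n,i}<\infty$, and coefficients $\psi(s)\to0$, $\sum_{r\ge0}r^{d-1}\psi(r)<\infty$. Moreover $\overline\alpha(u,v,r)\le(u+v)^\tau\hat\alpha(r)$, $\tau\ge0$, $\hat\alpha(r)\to0$, $\sum_{r\ge1}r^{d-1}\hat\alpha(r)<\infty$. A.3) $\Theta\times\Gamma$ is a compact subset of $\mathbb R^{p+q}$ with metric $\nu$ (the same symbol is used for the metric on $\Theta$ and on $\Gamma$). A.4) $q_g,s_g,h_g$ are measurable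 in the data for each $(\theta,\gamma)$ and Lipschitz continuous on $\Theta\times\Gamma$. A.5) With $m_{g,i},y_{g,i},w_{g,i,j}$ the entries of $\mathbf m_g(\theta)$, $\mathbf y_g$, $\mathbf W_g^{-1}(\theta,\gamma)$: $E\sup_\theta|m_{g,i}|^r\le C_1$, $E\sup_{\theta,\gamma}|w_{g,i,j}|^r\le C_2$, $E|y_{g,i}|^r\le C_3$, $E\sup_\theta|\nabla_\theta m_{g,i}|^r\le C_4$ for constants $C_1,\dots,C_4$ and some $r>\max(4p',4p'')$, $p',p''>1$. $m_{g,i}$ and $w_{g,i,j}$ are continuously differentiable up to third order, and the $r$th moments of the suprema over the parameter space of their derivatives up to second order are bounded. Non-random constants $c_{g,q},c_{g,s},c_{g,h}>0$ are such that $E|q_g/c_{g,q}|^{p''}<\infty$, $E|s_g/c_{g,s}|_2^{p''}<\infty$, $E|h_g/c_{g,h}|_1^{p''}<\infty$. Put $d_g=\max_{i\in B_g}d_{n,i}$ and $M_G=\max_g\max(d_g,c_{g,q},c_{g,s},c_{g,h})$; $\sup_G\sup_g\max(c_{g,q},c_{g,s},c_{g,h})/d_g\le C_5$ for a constant $C_5$. A.6) The grouped field $\tilde\varepsilon=\{\varepsilon_g\}_{g=1}^G$, $\varepsilon_g=(\varepsilon_i)_{i\in B_g}$, has mixing coefficients (for unions of at most $u$ and at most $v$ groups at distance $\ge r$) $\tilde\alpha(u,v,r)\le(u+v)^\tau L^\tau\hat\alpha(r)$, and $\sum_{r\ge1}L^\tau r^{d-1}\hat\alpha(r)<\infty$.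 A.7) With $e_i$ the $i$th unit vector of $\mathbb R^p$, $\mathbf 1$ the vector of ones in $\mathbb R^L$, $|\cdot|_a$ the elementwise absolute value, $b_{ij}=e_i^\top(\mathbf 1^\top\mathbf W_g^{-1}(\theta,\gamma)\otimes I_p)\,|\partial\mathrm{Vec}(\nabla\mathbf m_g^\top(\theta))/\partial\theta|_a\,e_j$ and $c_{ij}=e_i^\top(\mathbf 1^\top\otimes\nabla\mathbf m_g^\top(\theta))\,|\partial\mathrm{Vec}(\mathbf W_g^{-1}(\theta,\gamma))/\partial\theta|_a\,e_j$, the norms $\|\sup_{\theta,\gamma}b_{ij}\|$ and $\|\sup_{\theta,\gamma}c_{ij}\|$ are finite. A.8) (Identifiability) $\theta^0,\gamma^0$ are identifiably unique in the sense that, for $\epsilon>0$, $\liminf_{G\to\infty}\inf_{\theta\in\Theta:\nu(\theta,\theta^0)\ge\epsilon}Q_G(\theta,\gamma)>c_0>0$ for any $\gamma$ and a positive constant $c_0$.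
   Formalization: The scaled moments in A.5 are assumed bounded uniformly over groups and G (for each parameter), and in A.4 the Lipschitz coefficients of q_g, summed and divided by M_G G, are assumed bounded in mean; without these the claim fails when M_G→0. *)

(* Defs.v *)
From HB Require Import structures.
From mathcomp Require Import all_boot all_order all_algebra.
From mathcomp Require Import all_classical all_reals all_analysis.
From mathcomp Require Import mxtens.

Set Implicit Arguments.
Unset Strict Implicit.
Unset Printing Implicit Defensive.
Import Order.TTheory GRing.Theory Num.Theory.
Import numFieldNormedType.Exports.

Local Open Scope classical_set_scope.
Local Open Scope ring_scope.

(* Matrices with the Borel sigma-algebra of R^(m x n). *)
Definition mx_cylinders (R : realType) (m n : nat) : set (set 'M[R]_(m, n)) :=
  \bigcup_(ij in [set: 'I_m * 'I_n])
    preimage_set_system setT (fun A : 'M[R]_(m, n) => A ij.1 ij.2) measurable.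

Definition mxR (R : realType) (m n : nat) :=
  g_sigma_algebraType (@mx_cylinders R m n).

Definition l2norm (R : realType) (m n : nat) (A : 'M[R]_(m, n)) : R :=
  Num.sqrt (\sum_i \sum_j A i j ^+ 2).

Definition l1norm (R : realType) (m n : nat) (A : 'M[R]_(m, n)) : R :=
  \sum_i \sum_j `|A i j|.

Definition nu (R : realType) (p : nat) (a b : 'rV[R]_p) : R := l2norm (a - b).

Definition nu2 (R : realType) (p q : nat) (a b : 'rV[R]_p * 'rV[R]_q) : R :=
  nu (row_mx a.1 a.2) (row_mx b.1 b.2).

(* Column stacking; the index convention (column, row) is that of tensmx. *)
Definition Vec (R : realType) (m n : nat) (A : 'M[R]_(m, n)) : 'cV[R]_(n * m) :=
  \col_k A (mxtens_unindex k).2 (mxtens_unindex k).1.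

Definition abs_mx (R : realType) (m n : nat) (A : 'M[R]_(m, n)) :
  'M[R]_(m, n) := map_mx (fun a => `|a|) A.

(* The n x p matrix of partial derivatives dF_i/dtheta_j. *)
Definition grad (R : realType) (p n : nat) (F : 'rV[R]_p -> 'cV[R]_n)
    (theta : 'rV[R]_p) : 'M[R]_(n, p) :=
  \matrix_(i, j) 'D_(delta_mx 0 j) (fun t : 'rV[R]_p => F t i 0) theta.

Definition dir1 (R : realType) (p : nat) (j : 'I_p) : 'rV[R]_p := delta_mx 0 j.

Definition dir2 (R : realType) (p q : nat) (k : 'I_p + 'I_q) :
    'rV[R]_p * 'rV[R]_q :=
  match k with
  | inl j => (delta_mx 0 j, 0)
  | inr j => (0, delta_mx 0 j)
  end.

Definition iter_derive (R : realType) (V : normedModType R) (I : Type)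
    (e : I -> V) (s : seq I) (f : V -> R) : V -> R :=
  foldr (fun k g => (fun a => 'D_(e k) g a)) f s.

(* f has continuous partial derivatives (along the directions e) up to order n
   on an open neighbourhood of S. *)
Definition cont_diff (R : realType) (V : normedModType R) (I : Type)
    (e : I -> V) (n : nat) (S : set V) (f : V -> R) : Prop :=
  exists U : set V, [/\ open U, S `<=` U &
    forall s : seq I,
      ((size s <= n)%N ->
        forall a, U a -> {for a, continuous (iter_derive e s f)}) /\
      ((size s < n)%N ->
        forall k a, U a -> derivable (iter_derive e s f) a (e k))].

Section probability.
Context (R : realType) (dO : measure_display) (Om : measurableType dO)
  (P : probability Om R).

Definition is_cond_exp (F : set (set Om)) (f h : Om -> R) : Prop :=
  [/\ forall B, measurable B -> F (h @^-1` B),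
      P.-integrable setT (EFin \o h) &
      forall A, F A ->
        (\int[P]_(w in A) (h w)%:E = \int[P]_(w in A) (f w)%:E)%E].

Definition alpha (A B : set (set Om)) : \bar R :=
  ereal_sup [set z | exists X Y, [/\ A X, B Y &
    z = `|P (X `&` Y) - P X * P Y|%E]].

Definition sup_moment (T : Type) (r : R) (S : set T) (f : T -> Om -> R) :
    \bar R :=
  (\int[P]_w ereal_sup [set (`|f a w| `^ r)%:E | a in S])%E.

Definition moment (r : R) (f : Om -> R) : \bar R :=
  (\int[P]_w (`|f w| `^ r)%:E)%E.

End probability.

(* The norm of row vectors in the library is the max norm. *)
Definition rho (R : realType) (d : nat) (i j : 'rV[R]_d) : R := `|j - i|.

(* Extended-valued, so that the distance to the empty set is +oo. *)
Definition rho_set (R : realType) (d : nat) (U V : set 'rV[R]_d) : \bar R :=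
  ereal_inf [set z | exists i j, [/\ U i, V j & z = (rho i j)%:E]].

Section contributions.
Context (R : realType) (L p q : nat).
Context (m : 'M[R]_(L, p) -> 'rV[R]_p -> 'cV[R]_L)
  (W : 'M[R]_(L, p) -> 'rV[R]_p -> 'rV[R]_q -> 'M[R]_L).
Context (X : 'M[R]_(L, p)) (Y : 'cV[R]_L)
  (theta : 'rV[R]_p) (gamma : 'rV[R]_q).

Let res : 'cV[R]_L := Y - m X theta.
Let Winv : 'M[R]_L := invmx (W X theta gamma).
Let Dm : 'M[R]_(L, p) := grad (m X) theta.

Let DVecDm : 'M[R]_(L * p, p) :=
  grad (fun t => Vec (grad (m X) t)^T) theta.
Let DVecWinv : 'M[R]_(L * L, p) :=
  grad (fun t => Vec (invmx (W X t gamma))) theta.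

Definition q_fun : R := (res^T *m Winv *m res) 0 0.

Definition s_fun : 'cV[R]_p := Dm^T *m Winv *m res.

(* The casts identify 'M_(1 * p, p) with 'M_p. *)
Definition h_fun : 'M[R]_p :=
  - (Dm^T *m Winv *m Dm)
  + castmx (mul1n p, erefl p)
      (tensmx (res^T *m Winv) (1%:M : 'M[R]_p) *m DVecDm)
  + castmx (mul1n p, erefl p) (tensmx res^T Dm^T *m DVecWinv).

Let ones : 'rV[R]_L := const_mx 1.

Definition b_mx : 'M[R]_p :=
  castmx (mul1n p, erefl p)
    (tensmx (ones *m Winv) (1%:M : 'M[R]_p) *m abs_mx DVecDm).

Definition c_mx : 'M[R]_p :=
  castmx (mul1n p, erefl p) (tensmx ones Dm^T *m abs_mx DVecWinv).

End contributions.

(* The layer of the array with G groups consists of n = G * L sites; 'site G g'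
   enumerates the L members of group g.  Random variables at sites outside
   T_G (for y: outside D_G) are irrelevant. *)
Record gee_array (R : realType) (dO : measure_display) (Om : measurableType dO)
    (dE : measure_display) (E : measurableType dE) (d L p q : nat) := GeeArray {
  lattice : set 'rV[R]_d;
  Tsites : nat -> set 'rV[R]_d;
  site : forall G : nat, 'I_G -> 'I_L -> 'rV[R]_d;
  xrv : nat -> 'rV[R]_d -> {mfun Om >-> mxR R 1 p};
  innov : nat -> 'rV[R]_d -> {mfun Om >-> E};
  yrv : nat -> 'rV[R]_d -> {mfun Om >-> R};
  mean : forall G : nat, 'I_G -> 'M[R]_(L, p) -> 'rV[R]_p -> 'cV[R]_L;
  wcov : forall G : nat, 'I_G -> 'M[R]_(L, p) -> 'rV[R]_p -> 'rV[R]_q ->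
           'M[R]_L;
  dned : nat -> 'rV[R]_d -> R;
  cq : forall G : nat, 'I_G -> R;
  cs : forall G : nat, 'I_G -> R;
  ch : forall G : nat, 'I_G -> R }.

Section array.
Context (R : realType) (dO : measure_display) (Om : measurableType dO)
  (P : probability Om R) (dE : measure_display) (E : measurableType dE)
  (d L p q : nat) (M : gee_array R Om E d L p q).
Context (Theta : set 'rV[R]_p) (Gamma : set 'rV[R]_q).

Definition group (G : nat) (g : 'I_G) : set 'rV[R]_d := range (site M g).

Definition Dsites (G : nat) : set 'rV[R]_d :=
  \bigcup_(g in [set: 'I_G]) group g.

(* The groups are disjoint and each has exactly L elements. *)
Definition sampling_scheme : Prop :=
  forall G : nat,
    [/\ forall (g h : 'I_G) (l k : 'I_L),
          site M g l = site M h k -> g = h /\ l = k,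
        finite_set (Tsites M G), Dsites G `<=` Tsites M G &
        Tsites M G `<=` lattice M].

Definition eps (G : nat) (i : 'rV[R]_d) (w : Om) : mxR R 1 p * E :=
  (xrv M G i w, innov M G i w).

Definition sigma_eps (G : nat) (U : set 'rV[R]_d) : set (set Om) :=
  <<s \bigcup_(i in U) preimage_set_system setT (eps G i) measurable >>.

Definition xg (G : nat) (g : 'I_G) (w : Om) : 'M[R]_(L, p) :=
  \matrix_(l, k) (xrv M G (site M g l) w : 'rV[R]_p) 0 k.

Definition yg (G : nat) (g : 'I_G) (w : Om) : 'cV[R]_L :=
  \col_l yrv M G (site M g l) w.

Definition sigma_xg (G : nat) (g : 'I_G) : set (set Om) :=
  <<s preimage_set_system setT (xg g : Om -> mxR R L p) measurable >>.

Definition q_g (G : nat) (g : 'I_G) theta gamma (w : Om) : R :=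
  q_fun (mean M g) (wcov M g) (xg g w) (yg g w) theta gamma.

Definition s_g (G : nat) (g : 'I_G) theta gamma (w : Om) : 'cV[R]_p :=
  s_fun (mean M g) (wcov M g) (xg g w) (yg g w) theta gamma.

Definition h_g (G : nat) (g : 'I_G) theta gamma (w : Om) : 'M[R]_p :=
  h_fun (mean M g) (wcov M g) (xg g w) (yg g w) theta gamma.

Definition d_g (G : nat) (g : 'I_G) : R :=
  \big[Num.max/0]_(l < L) dned M G (site M g l).

Definition c_g (G : nat) (g : 'I_G) : R :=
  Num.max (cq M g) (Num.max (cs M g) (ch M g)).

Definition M_ (G : nat) : R := \big[Num.max/0]_(g < G) Num.max (d_g g) (c_g g).

Definition Q_ (G : nat) theta gamma (w : Om) : R :=
  (M_ G * G%:R)^-1 * \sum_(g < G) q_g g theta gamma w.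

Definition S_ (G : nat) theta gamma (w : Om) : 'cV[R]_p :=
  (M_ G * G%:R)^-1 *: \sum_(g < G) s_g g theta gamma w.

Definition correctly_specified (theta0 : 'rV[R]_p) : Prop :=
  forall (G : nat) (g : 'I_G) (l : 'I_L),
    is_cond_exp P (sigma_xg g) (fun w => yg g w l 0)
      (fun w => mean M g (xg g w) theta0 l 0).

Definition working_covariance : Prop :=
  forall (G : nat) (g : 'I_G) (w : Om) theta gamma,
    Theta theta -> Gamma gamma ->
    let V := wcov M g (xg g w) theta gamma in
    [/\ V^T = V, forall v : 'cV[R]_L, 0 <= (v^T *m V *m v) 0 0 &
        V \in unitmx].

(* (theta0, gamma0) is the unique minimiser of Qinf on Theta x Gamma and a zero
   of Sinf.  It cannot be asked to be the only zero of Sinf: under correct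
   specification Sinf(theta0, gamma) = 0 for every gamma. *)
Definition true_parameter (Qinf : 'rV[R]_p -> 'rV[R]_q -> R)
    (Sinf : 'rV[R]_p -> 'rV[R]_q -> 'cV[R]_p)
    (theta0 : 'rV[R]_p) (gamma0 : 'rV[R]_q) : Prop :=
  [/\ (forall theta gamma, Theta theta -> Gamma gamma ->
        (fun G => 'E_P[Q_ G theta gamma])%E @ \oo --> (Qinf theta gamma)%:E),
      (forall theta gamma, Theta theta -> Gamma gamma -> forall i,
        (fun G => 'E_P[fun w => (S_ G theta gamma w i 0)%R])%E @ \oo -->
          (Sinf theta gamma i 0)%:E),
      Theta theta0 /\ Gamma gamma0,
      (forall theta gamma, Theta theta -> Gamma gamma ->
        (theta, gamma) <> (theta0, gamma0) ->
        Qinf theta0 gamma0 < Qinf theta gamma) &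
      Sinf theta0 gamma0 = 0].

(* L_a-NED of y on eps, with the constants 'dned M' and coefficients psi *)
Definition NED (a : R) (psi : nat -> R) : Prop :=
  [/\ forall s, 0 <= psi s,
      psi @ \oo --> (0 : R),
      forall G i, Dsites G i -> 0 < dned M G i &
      forall G i (s : nat), Dsites G i ->
        exists2 h : Om -> R,
          is_cond_exp P
            (sigma_eps G [set j | Tsites M G j /\ rho i j <= s%:R])
            (yrv M G i) h &
          (Lnorm P a%:E (fun w => (yrv M G i w - h w)%:E)
             < (dned M G i * psi s)%:E)%E].

Definition uniformly_NED (a : R) (psi : nat -> R) : Prop :=
  NED a psi /\ exists K : R, forall G i, Dsites G i -> dned M G i <= K.

Definition alpha_bar (u v : nat) (h : R) : \bar R :=
  ereal_sup [set z | exists G U V,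
    [/\ U `<=` Tsites M G, V `<=` Tsites M G,
        (U #<= `I_u)%card /\ (V #<= `I_v)%card,
        (h%:E <= rho_set U V)%E &
        z = alpha P (sigma_eps G U) (sigma_eps G V)]].

Definition rho_groups (G : nat) (U V : {set 'I_G}) : \bar R :=
  ereal_inf [set z | exists g h,
    [/\ g \in U, h \in V & z = rho_set (group g) (group h)]].

Definition sigma_groups (G : nat) (U : {set 'I_G}) : set (set Om) :=
  sigma_eps G (\bigcup_(g in [set` U]) group g).

Definition alpha_tilde (u v : nat) (h : R) : \bar R :=
  ereal_sup [set z | exists G (U V : {set 'I_G}),
    [/\ (#|U| <= u)%N, (#|V| <= v)%N, (h%:E <= rho_groups U V)%E &
        z = alpha P (sigma_groups U) (sigma_groups V)]].

Definition A1 : Prop :=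
  [/\ countable (lattice M), infinite_set (lattice M) &
      exists2 rho0 : R, 1 < rho0 &
        forall i j, lattice M i -> lattice M j -> i <> j -> rho0 <= rho i j].

Definition A2 (psi : nat -> R) (tau : R) (ahat : nat -> R) : Prop :=
  [/\ uniformly_NED 4 psi,
      cvgn (series (fun r : nat => r%:R ^+ d.-1 * psi r)),
      0 <= tau,
      (forall u v r : nat,
        (alpha_bar u v r%:R <= ((u + v)%:R `^ tau * ahat r)%:E)%E) &
      ahat @ \oo --> (0 : R) /\
      cvgn (series (fun r : nat => r.+1%:R ^+ d.-1 * ahat r.+1))].

Definition A3 : Prop := compact (Theta `*` Gamma).

(* The constant K may depend on the data. *)
Definition lipschitz_at (m n : nat)
    (f : 'rV[R]_p -> 'rV[R]_q -> Om -> 'M[R]_(m, n))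
    (norm : 'M[R]_(m, n) -> R) (w : Om) (K : R) : Prop :=
  forall a b, (Theta `*` Gamma) a -> (Theta `*` Gamma) b ->
    norm (f a.1 a.2 w - f b.1 b.2 w) <= K * nu2 a b.

(* For the array of the q_g the Lipschitz coefficients Bq g are moreover
   required to be bounded in mean, after the averaging that defines Q_G: a
   Lipschitz constant that is unrestricted along the array gives no
   equicontinuity. *)
Definition A4 : Prop :=
  [/\ (forall (G : nat) (g : 'I_G) theta gamma, Theta theta -> Gamma gamma ->
        [/\ measurable_fun setT (fun z : mxR R L p * mxR R L 1 =>
              q_fun (mean M g) (wcov M g) z.1 z.2 theta gamma),
            (forall i, measurable_fun setT (fun z : mxR R L p * mxR R L 1 =>
              s_fun (mean M g) (wcov M g) z.1 z.2 theta gamma i 0)) &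
            (forall i j, measurable_fun setT (fun z : mxR R L p * mxR R L 1 =>
              h_fun (mean M g) (wcov M g) z.1 z.2 theta gamma i j))]),
      (exists Bq : forall G : nat, 'I_G -> Om -> R,
        [/\ forall (G : nat) (g : 'I_G), measurable_fun setT (Bq G g),
            forall (G : nat) (g : 'I_G) w a b,
              (Theta `*` Gamma) a -> (Theta `*` Gamma) b ->
              `|q_g g a.1 a.2 w - q_g g b.1 b.2 w| <= Bq G g w * nu2 a b,
            forall (G : nat) (g : 'I_G) w, 0 <= Bq G g w &
            exists K : R, forall G : nat,
              (\sum_(g < G) 'E_P[Bq G g] <= (K * (M_ G * G%:R))%:E)%E]),
      (forall (G : nat) (g : 'I_G) w,
        exists K, lipschitz_at (s_g g) (@l2norm R p 1) w K) &
      (forall (G : nat) (g : 'I_G) w,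
        exists K, lipschitz_at (h_g g) (@l1norm R p p) w K)].

Definition m_entry (G : nat) (g : 'I_G) (l : 'I_L) (theta : 'rV[R]_p)
    (w : Om) : R := mean M g (xg g w) theta l 0.

Definition w_entry (G : nat) (g : 'I_G) (l k : 'I_L)
    (a : 'rV[R]_p * 'rV[R]_q) (w : Om) : R :=
  invmx (wcov M g (xg g w) a.1 a.2) l k.

Definition A5_moments (r : R) : Prop :=
  exists C1 C2 C3 C4 : R, forall (G : nat) (g : 'I_G) (l k : 'I_L),
    [/\ (sup_moment P r Theta (m_entry g l) <= C1%:E)%E,
        (sup_moment P r (Theta `*` Gamma) (w_entry g l k) <= C2%:E)%E,
        (moment P r (fun w => (yg g w l 0)%R) <= C3%:E)%E &
        (sup_moment P r Theta
           (fun theta w => l2norm (row l (grad (mean M g (xg g w)) theta)))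
         <= C4%:E)%E].

Definition A5_smooth (r : R) : Prop :=
  (forall (G : nat) (g : 'I_G) (l k : 'I_L) w,
    cont_diff (@dir1 R p) 3 Theta (fun t => m_entry g l t w) /\
    cont_diff (@dir2 R p q) 3 (Theta `*` Gamma) (fun a => w_entry g l k a w)) /\
  (exists C : R, forall (G : nat) (g : 'I_G) (l k : 'I_L),
    (forall s : seq 'I_p, (size s <= 2)%N ->
      (sup_moment P r Theta (fun theta w =>
         iter_derive (@dir1 R p) s (fun t => m_entry g l t w) theta)
       <= C%:E)%E) /\
    (forall s : seq ('I_p + 'I_q), (size s <= 2)%N ->
      (sup_moment P r (Theta `*` Gamma) (fun a w =>
         iter_derive (@dir2 R p q) s (fun b => w_entry g l k b w) a)
       <= C%:E)%E)).

(* The scaled moments are bounded along the array, for each parameter value. *)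
Definition A5_scales (p'' : R) : Prop :=
  [/\ forall (G : nat) (g : 'I_G), [/\ 0 < cq M g, 0 < cs M g & 0 < ch M g],
      (forall theta gamma, Theta theta -> Gamma gamma ->
        exists C : R, forall (G : nat) (g : 'I_G),
        [/\ (moment P p'' (fun w => (q_g g theta gamma w / cq M g)%R) <= C%:E)%E,
            (moment P p'' (fun w => l2norm ((cs M g)^-1 *: s_g g theta gamma w)%R)
             <= C%:E)%E &
            (moment P p'' (fun w => l1norm ((ch M g)^-1 *: h_g g theta gamma w)%R)
             <= C%:E)%E]) &
      exists C5 : R, forall (G : nat) (g : 'I_G), c_g g / d_g g <= C5].

Definition A5 : Prop :=
  exists r p' p'' : R,
    [/\ 1 < p', 1 < p'', Num.max (4 * p') (4 * p'') < r &
        [/\ A5_moments r, A5_smooth r & A5_scales p'']].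

Definition A6 (tau : R) (ahat : nat -> R) : Prop :=
  (forall u v r : nat,
    (alpha_tilde u v r%:R
     <= ((u + v)%:R `^ tau * L%:R `^ tau * ahat r)%:E)%E) /\
  cvgn (series (fun r : nat =>
    L%:R `^ tau * r.+1%:R ^+ d.-1 * ahat r.+1)).

Definition A7 : Prop :=
  forall (G : nat) (g : 'I_G) (i j : 'I_p),
    (Lnorm P 2%:E (fun w => ereal_sup [set
        (b_mx (mean M g) (wcov M g) (xg g w) a.1 a.2 i j)%:E
      | a in Theta `*` Gamma]) < +oo)%E /\
    (Lnorm P 2%:E (fun w => ereal_sup [set
        (c_mx (mean M g) (wcov M g) (xg g w) a.1 a.2 i j)%:E
      | a in Theta `*` Gamma]) < +oo)%E.

(* Q_G is random: the inequality is meant almost surely. *)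
Definition A8 (theta0 : 'rV[R]_p) : Prop :=
  forall e : R, 0 < e -> exists2 c0 : R, 0 < c0 &
    forall gamma, Gamma gamma ->
      {ae P, forall w,
        (c0%:E < limn_einf (fun G => ereal_inf
          [set (Q_ G theta gamma w)%:E
          | theta in [set t | Theta t /\ (e <= nu t theta0)%R]]))%E}.

Definition gee_estimator (thetahat : nat -> {mfun Om >-> mxR R 1 p})
    (gammahat : nat -> {mfun Om >-> mxR R 1 q}) : Prop :=
  forall (G : nat) (w : Om),
    [/\ Theta (thetahat G w), Gamma (gammahat G w) &
        forall theta gamma, Theta theta -> Gamma gamma ->
          Q_ G (thetahat G w) (gammahat G w) w <= Q_ G theta gamma w].

End array.

(* Main.v *)
(* Write Z_g = q_g / M_G: these are nonnegative and bounded in L_p'' with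
   p'' > 1.  Let y^s be the conditional expectation of y given the innovations at
   distance at most s, and Z_g^s the value of Z_g with y^s in place of y.  Since
   Z_g is the square of a seminorm of y - m,
     |Z_g - Z_g^s| <= eta Z_g + (1 + 1/eta) (y - y^s)^T W^-1 (y - y^s) / M_G,
   so no moment of m is needed to see that Z_g^s is close to Z_g in L_1.
   Replacing Z_g^s by a step function of it, one is left with means of indicators,
   whose variance is a sum of terms P(A n B) - P(A) P(B): these are small for
   distant groups, by mixing, and each group has boundedly many neighbours
   because the sites are separated.  Hence Q_G - E Q_G tends to 0 in L_1 at each
   parameter.  As the Lipschitz coefficients of Q_G are bounded in mean, finitely
   many balls whose radii are proportional to the gaps Q_oo(a) - Q_oo(a0) then
   confine the minimiser of Q_G to a small ball around a0. *)
Require Import Defs.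
From HB Require Import structures.
From mathcomp Require Import all_boot all_order all_algebra.
From mathcomp Require Import all_classical all_reals all_analysis.
From mathcomp Require Import mxtens.
From mathcomp Require Import finmap measurable_realfun.
From mathcomp Require Import ring lra.

Set Implicit Arguments.
Unset Strict Implicit.
Unset Printing Implicit Defensive.
Import Order.TTheory GRing.Theory Num.Theory.
Import numFieldNormedType.Exports.

Local Open Scope classical_set_scope.
Local Open Scope ring_scope.

(** * L_1 bounds for random variables *)

Lemma measurable_ge_set (R : realType) d (T : measurableType d) (f : T -> R) t :
  measurable_fun setT f -> measurable [set w | t <= f w].
Proof.
move=> mf; have := mf measurableT _ (measurable_itv `[t, +oo[); rewrite setTI.
by congr measurable; apply/seteqP; split => w /=; rewrite in_itv/= andbT.
Qed.

Section L1_bounds.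
Context (R : realType) (dO : measure_display) (Om : measurableType dO)
  (P : probability Om R).
Implicit Types (f g : Om -> R) (a b c : R).

(** The bound is put on the extended integral, so that finiteness, hence integrability, comes with
    it and need not be carried separately. *)
Definition L1_le f c :=
  measurable_fun setT f /\ (\int[P]_w `|f w|%:E <= c%:E)%E.

Lemma L1_le_integrable f c : L1_le f c -> P.-integrable setT (EFin \o f).
Proof.
move=> [mf fc]; apply/integrableP; split; first exact/measurable_EFinP.
exact: le_lt_trans fc (ltry _).
Qed.

Lemma L1_leE f c : P.-integrable setT (EFin \o f) ->
  \int[P]_w `|f w| <= c -> L1_le f c.
Proof.
move=> fi fc; split; first by apply/measurable_EFinP; exact: measurable_int fi.
rewrite -[leLHS]fineK ?lee_fin//.
exact: integrable_fin_num (integrable_norm fi).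
Qed.

Lemma L1_le_Rintegral f c : L1_le f c -> \int[P]_w `|f w| <= c.
Proof.
move=> fc; have fi := L1_le_integrable fc; rewrite -lee_fin fineK; first by case: fc.
exact: integrable_fin_num (integrable_norm fi).
Qed.

Lemma L1_le_bound f c : L1_le f c -> `|\int[P]_w f w| <= c.
Proof.
move=> fc; apply: le_trans (L1_le_Rintegral fc).
exact: le_normr_Rintegral (L1_le_integrable fc).
Qed.

Lemma L1_le_ge0 f c : L1_le f c -> 0 <= c.
Proof. by move=> /L1_le_bound; exact: le_trans (normr_ge0 _). Qed.

Lemma L1_le_weaken f a b : a <= b -> L1_le f a -> L1_le f b.
Proof. by move=> ab [mf fa]; split => //; apply: (le_trans fa); rewrite lee_fin. Qed.

Lemma L1_le_dom f g c : measurable_fun setT f -> L1_le g c ->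
  (forall w, `|f w| <= `|g w|) -> L1_le f c.
Proof.
move=> mf [mg gc] fg; split => //; apply: le_trans gc.
apply: ge0_le_integral => //=.
- by apply/measurable_EFinP; exact: measurableT_comp.
- by apply/measurable_EFinP; exact: measurableT_comp.
- by move=> x _; rewrite lee_fin.
Qed.

Lemma L1_le_norm f c : L1_le f c -> L1_le (fun w => `|f w|) c.
Proof.
move=> fc; apply: (L1_le_dom _ fc) => [|w]; last by rewrite normr_id.
by apply: measurableT_comp => //; case: fc.
Qed.

Lemma L1_leD f g a b : L1_le f a -> L1_le g b ->
  L1_le (fun w => f w + g w) (a + b).
Proof.
move=> fa gb; have [mf _] := fa; have [mg _] := gb.
have fi := L1_le_integrable fa; have gi := L1_le_integrable gb.
apply: L1_leE; first exact: integrableD fi gi.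
apply: le_trans (lerD (L1_le_Rintegral fa) (L1_le_Rintegral gb)).
have nfi := integrable_norm fi; have ngi := integrable_norm gi.
rewrite -RintegralD//; apply: le_Rintegral => //.
- apply: (@integrable_norm _ _ _ P setT (fun w => f w + g w)).
  exact: integrableD fi gi.
- exact: integrableD nfi ngi.
- by move=> x _; exact: ler_normD.
Qed.

Lemma L1_leZ f k a : L1_le f a -> L1_le (fun w => k * f w) (`|k| * a).
Proof.
move=> fa; have fi := L1_le_integrable fa.
have kfi : P.-integrable setT (EFin \o (fun w => k * f w)).
  exact: (integrableZl measurableT k fi).
apply: L1_leE => //.
under eq_Rintegral => w _ do rewrite normrM.
rewrite RintegralZl// ?ler_wpM2l//; first exact: L1_le_Rintegral.
exact: integrable_norm fi.
Qed.

Lemma Rintegral_prob_cst k : \int[P]_w k = k.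
Proof.
rewrite Rintegral_cst// [X in fine X](_ : _ = 1%E) ?mulr1//.
exact: probability_setT.
Qed.

Lemma L1_le_cst k : L1_le (fun=> k) `|k|.
Proof.
apply: L1_leE; first exact: finite_measure_integrable_cst.
by rewrite Rintegral_prob_cst.
Qed.

Lemma L1_le_sum (I : finType) (F : I -> Om -> R) (a : I -> R) :
  (forall i, L1_le (F i) (a i)) ->
  L1_le (fun w => \sum_i F i w) (\sum_i a i).
Proof.
move=> Fa; elim: (index_enum I) => [|i s IH].
  rewrite big_nil; have := L1_le_cst 0; rewrite normr0.
  by congr L1_le; apply/funext => w; rewrite big_nil.
rewrite big_cons; have := L1_leD (Fa i) IH.
by congr L1_le; apply/funext => w; rewrite big_cons.
Qed.

Lemma L1_leB f g a b : L1_le f a -> L1_le g b ->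
  L1_le (fun w => f w - g w) (a + b).
Proof.
move=> fa /(L1_leZ (-1)); rewrite normrN1 mul1r => /(L1_leD fa).
by congr L1_le; apply/funext => w; rewrite mulN1r.
Qed.

Lemma L1_le_centered f c : L1_le f c ->
  L1_le (fun w => f w - \int[P]_w f w) (c + c).
Proof.
move=> fc; apply: (L1_leB fc).
by apply: L1_le_weaken (L1_le_cst _); exact: L1_le_bound.
Qed.

Lemma L1_le_markov f c t : 0 < t -> L1_le f c ->
  (P [set w | (t <= `|f w|)%R] <= (c / t)%:E)%E.
Proof.
move=> t0 [mf fc].
have := @le_integral_comp_abse _ _ _ P _ measurableT (EFin \o f) t id.
move=> /(_ _ _ _ _ t0) h.
have {}h : (t%:E * P [set w | (t <= `|f w|)%R] <= c%:E)%E.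
  apply: le_trans fc; have := h; rewrite setTI; apply => //.
  - exact/measurable_EFinP.
have mA : measurable [set w | (t <= `|f w|)%R].
  by apply: measurable_ge_set; exact: measurableT_comp.
have Pfin : P [set w | (t <= `|f w|)%R] \is a fin_num by exact: fin_num_measure.
rewrite -[X in (X <= _)%E](fineK Pfin) lee_fin ler_pdivlMr//.
by rewrite mulrC -lee_fin EFinM fineK.
Qed.

End L1_bounds.

(** * Second moments of sums of centred indicators *)

Section indicator_sums.
Context (R : realType) (dO : measure_display) (Om : measurableType dO)
  (P : probability Om R).

Lemma Rintegral_sum (I : Type) (s : seq I) (F : I -> Om -> R) :
  (forall i, P.-integrable setT (EFin \o F i)) ->
  P.-integrable setT (EFin \o (fun w => \sum_(i <- s) F i w)) /\
  \int[P]_w (\sum_(i <- s) F i w) = \sum_(i <- s) \int[P]_w F i w.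
Proof.
move=> Fi; elim: s => [|i s [IH1 IH2]].
  split; last first.
    by under eq_Rintegral do rewrite big_nil; rewrite Rintegral_prob_cst big_nil.
  apply: (@eq_integrable _ _ _ P setT measurableT (EFin \o cst 0)).
    by move=> w _ /=; rewrite big_nil.
  exact: finite_measure_integrable_cst.
have E : (fun w => \sum_(j <- i :: s) F j w) = fun w => F i w + \sum_(j <- s) F j w.
  by apply/funext => w; rewrite big_cons.
rewrite E big_cons; split; first exact: integrableD (Fi i) IH1.
by rewrite RintegralD// IH2.
Qed.

Lemma Rintegral_indicT (A : set Om) : measurable A ->
  \int[P]_w (\1_A w : R) = fine (P A).
Proof. by move=> mA; rewrite /Rintegral integral_indic// setIT. Qed.

Lemma indic_covariance (A B : set Om) : measurable A -> measurable B ->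
  let a := fine (P A) in let b := fine (P B) in
  P.-integrable setT (EFin \o (fun w => ((\1_A w : R) - a) * (\1_B w - b))) /\
  \int[P]_w (((\1_A w : R) - a) * (\1_B w - b)) = fine (P (A `&` B)) - a * b.
Proof.
move=> mA mB a b.
have iA C : measurable C -> P.-integrable setT (EFin \o (fun w => \1_C w : R)).
  by move=> mC; exact: integrable_indic.
have iC (k : R) : P.-integrable setT (EFin \o cst k).
  exact: finite_measure_integrable_cst.
have E : (fun w => ((\1_A w : R) - a) * (\1_B w - b)) =
    (fun w => (\1_(A `&` B) w + - a * \1_B w) + (- b * \1_A w + a * b)).
  by apply/funext => w; rewrite indicI /=; ring.
have iAB := iA _ (measurableI _ _ mA mB).
have iaB := integrableZl measurableT (- a) (iA _ mB).
have ibA := integrableZl measurableT (- b) (iA _ mA).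
have i1 := integrableD measurableT iAB iaB.
have i2 := integrableD measurableT ibA (iC (a * b)).
rewrite E; split; first exact: integrableD i1 i2.
rewrite RintegralD// (RintegralD _ iAB iaB)// (RintegralD _ ibA (iC _))//.
rewrite (RintegralZl (- a) _ (iA _ mB))// (RintegralZl (- b) _ (iA _ mA))//.
rewrite !Rintegral_indicT//; last exact: measurableI.
rewrite (Rintegral_prob_cst P (a * b)) -/a -/b; ring.
Qed.

(** Expanding the square and integrating leaves one covariance P(A_i n A_j) - P(A_i) P(A_j) per
    ordered pair of indices. *)
Lemma L1_le_indic_sum_sq (I : finType) (A : I -> set Om) (k : I -> I -> R) :
  (forall i, measurable (A i)) ->
  (forall i j, (`|P (A i `&` A j) - P (A i) * P (A j)| <= (k i j)%:E)%E) ->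
  L1_le P (fun w => (\sum_i ((\1_(A i) w : R) - fine (P (A i)))) ^+ 2)
    (\sum_i \sum_j k i j).
Proof.
move=> mA Ak.
pose F i j w := ((\1_(A i) w : R) - fine (P (A i))) * (\1_(A j) w - fine (P (A j))).
have Fi i j := (indic_covariance (mA i) (mA j)).1.
have FE i j := (indic_covariance (mA i) (mA j)).2.
have Gi i := (Rintegral_sum (index_enum I) (Fi i)).1.
have GE i := (Rintegral_sum (index_enum I) (Fi i)).2.
have Hi := (Rintegral_sum (index_enum I) Gi).1.
have HE := (Rintegral_sum (index_enum I) Gi).2.
have E : (fun w => (\sum_i ((\1_(A i) w : R) - fine (P (A i)))) ^+ 2) =
    (fun w => \sum_i \sum_j F i j w).
  by apply/funext => w; rewrite expr2 big_distrlr.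
apply: L1_leE; first by rewrite E.
under eq_Rintegral => w _ do rewrite ger0_norm ?sqr_ge0//.
rewrite E HE; apply: ler_sum => i _; rewrite GE; apply: ler_sum => j _.
rewrite FE; apply: le_trans (ler_norm _) _.
have fA B : measurable B -> P B \is a fin_num by move=> mB; exact: fin_num_measure.
have := Ak i j; rewrite -(fineK (fA _ (mA i))) -(fineK (fA _ (mA j))).
by rewrite -(fineK (fA _ (measurableI _ _ (mA i) (mA j)))) -EFinM -EFinB lee_fin.
Qed.

(** For every l > 0 one has |f| <= l + f^2 / l. The best l is of order sqrt V; leaving it free
    avoids square roots. *)
Lemma L1_le_sq (f : Om -> R) V l : 0 < l -> measurable_fun setT f ->
  L1_le P (fun w => f w ^+ 2) V -> L1_le P f (l + l^-1 * V).
Proof.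
move=> l0 mf /(L1_leZ l^-1) /(L1_leD (L1_le_cst P l)).
rewrite !gtr0_norm ?invr_gt0// => h; apply: L1_le_dom mf h _ => w.
rewrite [leRHS]ger0_norm; last first.
  by apply: addr_ge0 (ltW l0) _; rewrite mulr_ge0 ?sqr_ge0 ?invr_ge0 ?(ltW l0).
rewrite -(ler_pM2l l0) mulrDr mulrA mulfV ?gt_eqF// mul1r.
rewrite -(real_normK (num_real (f w))); nra.
Qed.

End indicator_sums.

(** * Counting sites and groups near a given group *)

Lemma card_le_finType (T : Type) (F : finType) (A : set T) (f : T -> F) :
  {in A &, injective f} -> (A #<= `I_#|F|)%card.
Proof.
move=> finj; pose g x : nat := enum_rank (f x).
have ginj : {in A &, injective g}.
  by move=> x y Ax Ay /val_inj/enum_rank_inj; exact: finj.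
apply: (@card_le_trans _ _ _ (g @` A)).
  by have := inj_card_eq ginj; rewrite card_eq_le => /andP[].
by apply: subset_card_le => _ [x _ <-] /=; exact: ltn_ord.
Qed.

Section separated_sites.
Context (R : realType) (d : nat).
Implicit Types (i j c : 'rV[R]_d) (n : nat).

Lemma ler_coord_mx_norm (m n : nat) (A : 'M[R]_(m, n)) a b :
  `|A a b| <= `|A|.
Proof. by rewrite [leRHS]/Num.norm/= mx_normrE; exact: (le_bigmax _ _ (a, b)). Qed.

Lemma mx_norm_le (m n : nat) (A : 'M[R]_(m, n)) (e : R) : 0 <= e ->
  (forall a b, `|A a b| <= e) -> `|A| <= e.
Proof.
move=> e0 Ae; rewrite /Num.norm/= mx_normrE; apply/bigmax_leP.
by split => // -[a b] _; exact: Ae.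
Qed.

(** The index of the unit cell of j in a grid with corner c - n. Points within n of c have shifted
    coordinates in [0, 2n], hence 2n + 1 possible integer parts; the default of [inord] can only
    occur further away. *)
Definition box n c j : {ffun 'I_d -> 'I_n.*2.+1} :=
  [ffun l => inord (Num.truncn (j 0 l - c 0 l + n%:R))].

Lemma box_eq n c i j : rho c i <= n%:R -> rho c j <= n%:R ->
  box n c i = box n c j -> rho i j <= 1.
Proof.
move=> ci cj bij; apply: mx_norm_le => // a l; rewrite {a}ord1 !mxE.
have H k : rho c k <= n%:R ->
    [/\ 0 <= k 0 l - c 0 l + n%:R,
        (Num.truncn (k 0 l - c 0 l + n%:R)%R < n.*2.+1)%N &
        (box n c k l : nat) = Num.truncn (k 0 l - c 0 l + n%:R)].
  move=> ck; have : `|(k - c) 0 l| <= n%:R.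
    by apply: le_trans ck; exact: ler_coord_mx_norm.
  rewrite !mxE ler_norml => /andP[h1 h2].
  have h3 : 0 <= k 0 l - c 0 l + n%:R by lra.
  have h4 : (Num.truncn (k 0 l - c 0 l + n%:R)%R < n.*2.+1)%N.
    have -> : n.*2.+1 = (n + n + 1)%N by rewrite addnn addn1.
    rewrite truncn_lt_nat// !natrD; lra.
  by split => //; rewrite ffunE inordK.
have [i0 _ iE] := H _ ci; have [j0 _ jE] := H _ cj.
have E : Num.truncn (i 0 l - c 0 l + n%:R) = Num.truncn (j 0 l - c 0 l + n%:R).
  by rewrite -iE -jE bij.
have /andP[] := truncn_itv i0; have /andP[] := truncn_itv j0; rewrite E.
move: (Num.truncn _) => t; rewrite -[t.+1]addn1 natrD ler_norml => *.
by apply/andP; split; lra.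
Qed.

Context (S : set 'rV[R]_d).
Context (sepS : forall i j, S i -> S j -> i <> j -> 1 < rho i j).

(** Cells have side 1 while distinct points of [S] are more than 1 apart, so a cell contains at most
    one of them. *)
Lemma box_inj n c i j : S i -> S j -> rho c i <= n%:R -> rho c j <= n%:R ->
  box n c i = box n c j -> i = j.
Proof.
move=> Si Sj ci cj /(box_eq ci cj) ij; apply: contrapT => /(sepS Si Sj).
by rewrite ltNge ij.
Qed.

(** A site is encoded by a member of the group near it and by its cell around that member: equal
    codes refer to the same centre, so [box_inj] applies. *)
Lemma card_neighbours (L n : nat) (site : 'I_L -> 'rV[R]_d) :
  ([set j | S j /\ exists l, rho (site l) j <= n%:R]
    #<= `I_#|{: option 'I_L * {ffun 'I_d -> 'I_n.*2.+1}}|)%card.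
Proof.
pose pk j := [pick l | rho (site l) j <= n%:R].
pose f j := (pk j, if pk j is Some l then box n (site l) j else box n 0 j).
apply: (@card_le_finType _ _ _ f) => i j /set_mem[Si [l il]] /set_mem[Sj [k jk]].
rewrite /f /pk; case: pickP => [a ia|/(_ l)]; last by rewrite il.
case: pickP => [b jb|/(_ k)]; last by rewrite jk.
by case=> ab; rewrite -ab in jb *; exact: box_inj.
Qed.

(** A group h is encoded by a pair of nearby members of g and h and by the cell of the second around
    the first. Two groups with the same code share a site, hence are equal. *)
Lemma card_near_groups (G L n : nat) (site : 'I_G -> 'I_L -> 'rV[R]_d) (g : 'I_G) :
  (forall h k, S (site h k)) ->
  (forall h h' k k', site h k = site h' k' -> h = h') ->
  (#|[pred h | [exists l, exists k, rho (site g l) (site h k) <= n%:R]%R]|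
    <= #|{: option ('I_L * 'I_L) * {ffun 'I_d -> 'I_n.*2.+1}}|)%N.
Proof.
move=> siteS site_inj.
pose pk h := [pick lk : 'I_L * 'I_L | rho (site g lk.1) (site h lk.2) <= n%:R].
pose f h := (pk h, if pk h is Some lk then box n (site g lk.1) (site h lk.2)
                   else box n 0 0).
apply: (@leq_card_in _ _ f) => // h h' /existsP[l /existsP[k hlk]].
move=> /existsP[l' /existsP[k' hlk']].
rewrite /f /pk; case: pickP => [[a b] hab|/(_ (l, k))]; last by rewrite hlk.
case: pickP => [[a' b'] hab'|/(_ (l', k'))]; last by rewrite hlk'.
move=> /= [? ?]; subst a' b' => /= /(box_inj (siteS _ _) (siteS _ _) hab hab').
exact: site_inj.
Qed.

End separated_sites.

(** * A weak law for fields approximated by step functions *)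

Section weak_law.
Context (R : realType) (dO : measure_display) (Om : measurableType dO)
  (P : probability Om R).

Lemma covariance_le1 (A B : set Om) : measurable A -> measurable B ->
  (`|P (A `&` B) - P A * P B| <= 1)%E.
Proof.
move=> mA mB; have mAB := measurableI _ _ mA mB.
have H C : measurable C -> exists2 r : R, P C = r%:E & 0 <= r <= 1.
  move=> mC; exists (fine (P C)).
    by rewrite fineK//; exact: fin_num_measure.
  rewrite -!lee_fin fineK; last exact: fin_num_measure.
  by rewrite measure_ge0 probability_le1.
have [a -> /andP[a0 a1]] := H _ mA; have [b -> /andP[b0 b1]] := H _ mB.
have [c -> /andP[c0 c1]] := H _ mAB.
rewrite -EFinM -EFinB lee_fin ler_norml; apply/andP; split; nra.
Qed.

(** Of the G^2 pairs of groups at most G C are near, with covariances at most 1; the others have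
    covariances at most k. Each pair of groups yields N^2 pairs of events, and dividing by G^2 gives
    the variance bound del^2 N^2 (C / G + k), which [L1_le_sq] turns into an L_1 bound. *)
Lemma L1_le_mean_indic (G N C : nat) (A : 'I_G -> 'I_N -> set Om)
    (near : rel 'I_G) (k del l : R) : (0 < G)%N -> 0 < l -> 0 <= k ->
  (forall g j, measurable (A g j)) ->
  (forall g, (#|near g| <= C)%N) ->
  (forall g h j i, ~~ near g h ->
    (`|P (A g j `&` A h i) - P (A g j) * P (A h i)| <= k%:E)%E) ->
  L1_le P (fun w => G%:R^-1 * \sum_g (del * \sum_j (\1_(A g j) w : R) -
      \int[P]_w (del * \sum_j (\1_(A g j) w : R))))
    (l + l^-1 * (del ^+ 2 * N%:R ^+ 2 * (C%:R / G%:R + k))).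
Proof.
move=> G0 l0 k0 mA nearC Ak.
pose B (i : 'I_G * 'I_N) := A i.1 i.2.
pose K (i j : 'I_G * 'I_N) : R := (near i.1 j.1)%:R + k.
have BK i j : (`|P (B i `&` B j) - P (B i) * P (B j)| <= (K i j)%:E)%E.
  rewrite /K; case: (boolP (near i.1 j.1)) => n; last by rewrite add0r; exact: Ak.
  apply: le_trans (covariance_le1 (mA _ _) (mA _ _)) _.
  by rewrite lee_fin lerDl.
have KV : \sum_i \sum_j K i j <= (N%:R ^+ 2) * (G%:R * C%:R + G%:R ^+ 2 * k).
  apply: (@le_trans _ _ (\sum_(i : 'I_G * 'I_N) N%:R * (C%:R + G%:R * k))).
    apply: ler_sum => -[g j] _; rewrite /K/=.
    rewrite -(pair_bigA _ (fun h (_ : 'I_N) => (near g h)%:R + k))/=.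
    under eq_bigr do rewrite sumr_const card_ord -[_ *+ N]mulr_natl.
    rewrite -mulr_sumr; apply: ler_wpM2l => //.
    rewrite big_split/= sumr_const card_ord -[_ *+ G]mulr_natl lerD2r -natr_sum ler_nat.
    by rewrite -big_mkcond/= sum1_card; exact: nearC.
  rewrite sumr_const card_prod !card_ord -[_ *+ _]mulr_natl natrM.
  by rewrite le_eqVlt; apply/orP; left; apply/eqP; ring.
have h := L1_le_weaken KV (L1_le_indic_sum_sq (fun i => mA i.1 i.2) BK).
have {}h := L1_leZ ((del / G%:R) ^+ 2) h.
pose f w := del / G%:R * \sum_i ((\1_(B i) w : R) - fine (P (B i))).
have fE : (fun w => G%:R^-1 * \sum_g (del * \sum_j (\1_(A g j) w : R) -
      \int[P]_w (del * \sum_j (\1_(A g j) w : R)))) = f.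
  have iA g j : P.-integrable setT (EFin \o (fun w => \1_(A g j) w : R)).
    by apply: integrable_indic.
  apply/funext => w; rewrite /f mulrAC mulrC; congr (_ / _).
  rewrite -(pair_bigA _ (fun g j => (\1_(A g j) w : R) - fine (P (A g j))))/=.
  rewrite mulr_sumr; apply: eq_bigr => g _.
  have [sI sE] := Rintegral_sum (index_enum 'I_N) (iA g).
  rewrite RintegralZl// sE -mulrBr; congr (_ * _); rewrite -sumrB.
  by apply: eq_bigr => j _; rewrite Rintegral_indicT.
rewrite fE; have mf : measurable_fun setT f.
  apply: measurable_funM => //; apply: measurable_sum => i.
  apply: measurable_funB => //. apply: measurable_indic; exact: mA.
apply: L1_le_sq => //.
have G0' : (G%:R : R) != 0 by rewrite pnatr_eq0 -lt0n.
move: h; rewrite ger0_norm ?sqr_ge0//.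
have -> : (del / G%:R) ^+ 2 * (N%:R ^+ 2 * (G%:R * C%:R + G%:R ^+ 2 * k)) =
  del ^+ 2 * N%:R ^+ 2 * (C%:R / G%:R + k) by field.
by congr L1_le; apply/funext => w; rewrite /f [RHS]exprMn.
Qed.

(** The step functions are fixed first, then k and the neighbour bound C are chosen for them; only
    then does G grow, which makes C / G small. The approximation error survives averaging, at most
    doubled by centring. *)
Lemma weak_law_of_approximations (Z : forall G, 'I_G -> Om -> R) :
  (forall e : R, 0 < e -> exists N (del : R)
      (A : forall G, 'I_G -> 'I_N -> set Om),
    [/\ forall G (g : 'I_G) j, measurable (A G g j),
        forall G (g : 'I_G),
          L1_le P (fun w => Z G g w - del * \sum_j (\1_(A G g j) w : R)) e &
        forall k : R, 0 < k -> exists C (near : forall G, rel 'I_G),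
          forall G (g : 'I_G), (#|near G g| <= C)%N /\
            forall h j i, ~~ near G g h ->
            (`|P (A G g j `&` A G h i) - P (A G g j) * P (A G h i)| <= k%:E)%E]) ->
  forall e : R, 0 < e -> \forall G \near \oo,
    L1_le P (fun w => G%:R^-1 * \sum_g (Z G g w - \int[P]_w Z G g w)) e.
Proof.
move=> approx e e0.
have e8 : 0 < e / 8 by rewrite divr_gt0.
have [N [del [A [mA ZA Acov]]]] := approx _ e8.
pose D : R := del ^+ 2 * N%:R ^+ 2.
have D0 : 0 <= D by rewrite mulr_ge0 ?sqr_ge0.
(* Once C / G <= k, this makes D (C / G + k) at most (e / 4)^2, and the weight l = e / 4 then gives
   e / 2; D + 1 covers the case D = 0. *)
pose k : R := (e / 4) ^+ 2 / (2 * (D + 1)).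
have D1 : 0 < 2 * (D + 1) by rewrite mulr_gt0// ltr_wpDl.
have k0 : 0 < k by rewrite divr_gt0// exprn_gt0// divr_gt0.
have [C [near nearP]] := Acov _ k0.
exists (Num.truncn (C%:R / k)).+1 => // G /= CG.
have G0 : (0 < G)%N by exact: leq_trans CG.
have G0' : 0 < (G%:R : R) by rewrite ltr0n.
have CGk : C%:R / G%:R <= k.
  rewrite ler_pdivrMr// mulrC -ler_pdivrMr//.
  apply: ltW; apply: lt_le_trans (_ : (Num.truncn (C%:R / k)).+1%:R <= _).
    by have /andP[] := truncn_itv (divr_ge0 (ler0n R C) (ltW k0)).
  by rewrite ler_nat.
pose X (g : 'I_G) w := del * \sum_j (\1_(A G g j) w : R).
have iX g : P.-integrable setT (EFin \o X g).
  have iA j : P.-integrable setT (EFin \o (fun w => \1_(A G g j) w : R)).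
    by apply: integrable_indic.
  exact: (integrableZl measurableT del (Rintegral_sum (index_enum 'I_N) iA).1).
have e4 : 0 < e / 4 by rewrite divr_gt0.
have h1 := L1_le_mean_indic del G0 e4 (ltW k0) (mA G) (fun g => (nearP G g).1)
  (fun g => (nearP G g).2).
have h2 : L1_le P (fun w => G%:R^-1 * \sum_g ((Z G g w - X g w) -
     \int[P]_w (Z G g w - X g w))) (e / 4).
  have := L1_leZ G%:R^-1 (L1_le_sum (fun g => L1_le_centered (ZA G g))).
  apply: L1_le_weaken; rewrite ger0_norm ?invr_ge0//.
  rewrite sumr_const card_ord -[(_ + _) *+ _]mulr_natl mulrA mulVf ?gt_eqF// mul1r.
  by rewrite le_eqVlt; apply/orP; left; apply/eqP; field.
have := L1_leD h2 h1.
have -> : (fun w => G%:R^-1 * \sum_g (Z G g w - X g w -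
    \int[P]_w (Z G g w - X g w)) +
    G%:R^-1 * \sum_g (del * \sum_j (\1_(A G g j) w : R) -
      \int[P]_w (del * \sum_j (\1_(A G g j) w : R)))) =
    (fun w => G%:R^-1 * \sum_g (Z G g w - \int[P]_w Z G g w)).
  apply/funext => w; rewrite -mulrDr -big_split/=; congr (_ * _).
  apply: eq_bigr => g _.
  have iZX := L1_le_integrable (ZA G g).
  have -> : \int[P]_w Z G g w = \int[P]_w (Z G g w - X g w) + \int[P]_w X g w.
    rewrite -RintegralD//; apply: eq_Rintegral => v _; by rewrite subrK.
  by rewrite /X; ring.
apply: L1_le_weaken.
have h3 : D * (C%:R / G%:R + k) <= (e / 4) ^+ 2.
  apply: (@le_trans _ _ ((D + 1) * (k + k))).
    apply: ler_pM => //; [|by rewrite lerDl|by rewrite lerD2r].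
    by rewrite addr_ge0// ?(ltW k0)// divr_ge0.
  rewrite /k le_eqVlt; apply/orP; left; apply/eqP.
  by field; rewrite gt_eqF// ltr_wpDl.
rewrite -/D; have : (e / 4)^-1 * (D * (C%:R / G%:R + k)) <= e / 4.
  by rewrite mulrC ler_pdivrMr// -expr2.
move=> h; have : e / 4 + (e / 4 + e / 4) <= e by lra.
lra.
Qed.

End weak_law.

(** * Consistency of minimisers of random Lipschitz criteria *)

Section argmin_consistency.
Context (R : realType) (dO : measure_display) (Om : measurableType dO)
  (P : probability Om R) (T : ptopologicalType).

(** Suppose the minimiser falls in the ball of a centre b other than a0. Of the gap Qinf b - Qinf
    a0, at most a quarter is lost in moving from b to the minimiser and less than a quarter to the
    deviations at b and a0. So Q at the minimiser would still exceed Q at a0, which is absurd. *)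
Lemma argmin_consistency (K : set T) (dist : T -> T -> R) (a0 : T)
    (Q : nat -> T -> Om -> R) (Qinf : T -> R) (B : nat -> Om -> R) (c : R)
    (ahat : nat -> Om -> T) (r : R) (E : nat -> set Om) :
  compact K -> K a0 ->
  (forall a b, 0 <= dist a b) ->
  (forall a e, 0 < e -> \forall b \near a, dist a b < e) ->
  (forall G w a b, K a -> K b -> `|Q G a w - Q G b w| <= B G w * dist a b) ->
  (forall G, L1_le P (B G) c) ->
  (forall a, K a -> forall e, 0 < e -> \forall G \near \oo,
    L1_le P (fun w => Q G a w - Qinf a) e) ->
  (forall a, K a -> a <> a0 -> Qinf a0 < Qinf a) ->
  (forall G w, K (ahat G w)) ->
  (forall G w, Q G (ahat G w) w <= Q G a0 w) ->
  0 < r -> (forall G, measurable (E G)) ->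
  (forall G w, E G w -> r <= dist a0 (ahat G w)) ->
  (fun G => P (E G)) @ \oo --> 0%E.
Proof.
move=> Kc Ka0 dist0 distN lip Bc Qlim gap Kahat argmin r0 mE Er.
apply/fine_cvgP; split.
  by apply: nearW => G; exact: fin_num_measure.
apply/cvgrPdist_le => /= e e0.
(* With this t the term |B| / t has mean at most e / 2. *)
pose t : R := 2 * (`|c| + 1) / e.
have c1 : 0 < `|c| + 1 by rewrite ltr_wpDl.
have t0 : 0 < t by rewrite divr_gt0// mulr_gt0.
pose g a := Qinf a - Qinf a0.
have g0 a : K a -> a <> a0 -> 0 < g a by move=> Ka aa0; rewrite subr_gt0; exact: gap.
(* The ball of a0 has radius r, so on [E G] it misses the minimiser. The other radii keep the
   Lipschitz variation from the centre at most g / 4 when |B| < t. *)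
pose rad a := if pselect (a = a0) then r else g a / (4 * t).
have rad0 a : K a -> 0 < rad a.
  rewrite /rad; case: pselect => // aa0 Ka.
  by apply: divr_gt0; [exact: g0|exact: mulr_gt0].
(* The hypotheses make a ball a neighbourhood of its centre, not an open set; interiors supply the
   open cover. *)
pose U a := [set b | dist a b < rad a]°.
have Ucov : K `<=` cover K U.
  by move=> a Ka; exists a => //; apply: distN; exact: rad0.
move: (Kc); rewrite compact_cover => /(_ _ K U (fun a _ => @open_interior _ _) Ucov).
move=> [D' D'K D'cov].
have KD (a : D') : K (val a) by apply: set_mem; exact: D'K (valP a).
(* At the centre a0 the gap is 0, so [k] is 4 / 0 = 0 and the term drops out of [F]. *)
pose k (a : D') : R := 4 / g (val a).
(* Off the event [1 <= F G w] the minimiser cannot lie in the ball of a centre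
   other than a0; the factors 4 / g turn each deviation into a fraction of a gap. *)
pose F G w := `|B G w| / t + \sum_(a : D') `|k a| *
  (`|Q G (val a) w - Qinf (val a)| + `|Q G a0 w - Qinf a0|).
(* The tolerances are such that the weighted deviations, summed over the centres, have mean at most
   e / 2; the added ones keep the denominators positive. *)
pose e1 := e / (2 * (#|{: D'}|%:R + 1)).
have D1 : 0 < (#|{: D'}|%:R + 1 : R) by rewrite ltr_wpDl.
have e10 : 0 < e1 by rewrite divr_gt0// mulr_gt0.
pose e2 (a : D') := e1 / (2 * (`|k a| + 1)).
have k1 a : 0 < `|k a| + 1 by rewrite ltr_wpDl.
have e20 a : 0 < e2 a by rewrite divr_gt0// mulr_gt0.
have nearQ : \forall G \near \oo, forall a : D',
    L1_le P (fun w => Q G (val a) w - Qinf (val a)) (e2 a) /\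
    L1_le P (fun w => Q G a0 w - Qinf a0) (e2 a).
  apply: filter_forall => a.
  by near=> G; split; near: G; apply: Qlim.
near=> G.
have QG : forall a : D',
    L1_le P (fun w => Q G (val a) w - Qinf (val a)) (e2 a) /\
    L1_le P (fun w => Q G a0 w - Qinf a0) (e2 a).
  by near: G.
have LF : L1_le P (F G) e.
  have h1 := L1_leZ t^-1 (L1_le_norm (Bc G)).
  have h2 := L1_le_sum (fun a : D' => L1_leZ `|k a|
    (L1_leD (L1_le_norm (QG a).1) (L1_le_norm (QG a).2))).
  have := L1_leD h1 h2.
  have -> : (fun w => t^-1 * `|B G w| + \sum_(a : D') `|k a| *
     (`|Q G (val a) w - Qinf (val a)| + `|Q G a0 w - Qinf a0|)) = F G.
    by apply/funext => w; rewrite /F mulrC.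
  apply: L1_le_weaken.
  have h3 : `|t^-1| * c <= e / 2.
    rewrite gtr0_norm ?invr_gt0// mulrC ler_pdivrMr// /t.
    have -> : e / 2 * (2 * (`|c| + 1) / e) = `|c| + 1 by field; rewrite gt_eqF.
    by apply: le_trans (ler_norm c) _; rewrite lerDl.
  have h4 : \sum_(a : D') `| `|k a| | * (e2 a + e2 a) <= e / 2.
    apply: (@le_trans _ _ (\sum_(a : D') e1)).
      apply: ler_sum => a _; rewrite normr_id /e2.
      have -> : `|k a| * (e1 / (2 * (`|k a| + 1)) + e1 / (2 * (`|k a| + 1))) =
         e1 * (`|k a| / (`|k a| + 1)) by field; rewrite gt_eqF.
      by rewrite ler_piMr ?(ltW e10)// ler_pdivrMr// mul1r lerDl.
    rewrite sumr_const -[_ *+ _]mulr_natl /e1.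
    have -> : #|{: D'}|%:R * (e / (2 * (#|{: D'}|%:R + 1))) =
       e / 2 * (#|{: D'}|%:R / (#|{: D'}|%:R + 1)) by field; rewrite gt_eqF.
    by rewrite ler_piMr ?divr_ge0 ?(ltW e0)// ler_pdivrMr// mul1r lerDl.
  lra.
have F1 w : E G w -> 1 <= `|F G w|.
  move=> Ew; rewrite leNgt; apply/negP => Fw.
  have F0 : 0 <= \sum_(a : D') `|k a| *
    (`|Q G (val a) w - Qinf (val a)| + `|Q G a0 w - Qinf a0|).
    by apply: sumr_ge0 => a _; rewrite mulr_ge0// addr_ge0.
  have B0 : 0 <= `|B G w| / t by rewrite divr_ge0// ltW.
  have {}Fw : F G w < 1 by apply: le_lt_trans Fw; exact: ler_norm.
  have Bt : `|B G w| < t.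
    by rewrite -[t]mul1r -ltr_pdivrMr//; apply: le_lt_trans Fw; rewrite /F lerDl.
  have [b /= bD' Ub] := D'cov _ (Kahat G w).
  pose a : D' := [` bD']%fset.
  have dab : dist b (ahat G w) < rad b by exact: (@interior_subset _ _ _ Ub).
  have Kb : K b by exact: (KD a).
  have [ba0|ba0] := pselect (b = a0).
    have := Er _ _ Ew; rewrite leNgt -{1}ba0; apply/negP/negPn.
    by move: dab; rewrite /rad; case: pselect.
  have gb := g0 _ Kb ba0.
  have ka : `|k a| = 4 / g b by rewrite gtr0_norm// divr_gt0.
  have : `|k a| * (`|Q G b w - Qinf b| + `|Q G a0 w - Qinf a0|) < 1.
    apply: le_lt_trans Fw; rewrite /F (bigD1 a)//= addrCA lerDl.
    by rewrite addr_ge0// sumr_ge0// => x _; rewrite mulr_ge0// addr_ge0.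
  have ka0 : 0 < 4 / g b by rewrite divr_gt0.
  rewrite ka mulrC -ltr_pdivlMr// mul1r invf_div => Qb.
  have Bd : B G w * dist b (ahat G w) <= g b / 4.
    apply: (@le_trans _ _ (t * rad b)).
      apply: (@le_trans _ _ (`|B G w| * dist b (ahat G w))).
        by rewrite ler_wpM2r// ler_norm.
      by apply: ler_pM => //; exact: ltW.
    rewrite /rad; case: pselect => //= ?.
    by rewrite le_eqVlt; apply/orP; left; apply/eqP; field; rewrite gt_eqF.
  have := lip G w _ _ Kb (Kahat G w); have := argmin G w.
  rewrite /g in gb Bd Qb.
  have := normr_ge0 (Q G b w - Qinf b); have := normr_ge0 (Q G a0 w - Qinf a0).
  have := ler_norm (Q G b w - Q G (ahat G w) w).
  have := ler_norm (Q G a0 w - Qinf a0).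
  have := ler_norm (- (Q G b w - Qinf b)); rewrite normrN.
  lra.
rewrite sub0r normrN ger0_norm ?fine_ge0//.
rewrite -lee_fin fineK; last exact: fin_num_measure.
have := L1_le_markov ltr01 LF; rewrite divr1; apply: le_trans.
apply: le_measure => [||w]; [exact/mem_set| |exact: F1].
apply/mem_set; apply: measurable_ge_set; apply: measurableT_comp => //.
by case: LF.
Unshelve. all: by end_near.
Qed.

End argmin_consistency.

(** * Positive semidefinite quadratic forms *)

Section quadratic_forms.
Context (R : realType) (L : nat).
Implicit Types (A W : 'M[R]_L) (u v : 'cV[R]_L).

Definition bform A u v : R := (u^T *m A *m v) 0 0.

Lemma bformE A u v : bform A u v = \sum_i \sum_j u i 0 * A i j * v j 0.
Proof.
rewrite /bform !mxE exchange_big/=; apply: eq_bigr => j _; rewrite !mxE mulr_suml.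
by apply: eq_bigr => i _; rewrite !mxE.
Qed.

Lemma bformDl A u u' v : bform A (u + u') v = bform A u v + bform A u' v.
Proof. by rewrite /bform raddfD/= !mulmxDl mxE. Qed.

Lemma bformDr A u v v' : bform A u (v + v') = bform A u v + bform A u v'.
Proof. by rewrite /bform mulmxDr mxE. Qed.

Lemma bformZl A a u v : bform A (a *: u) v = a * bform A u v.
Proof. by rewrite /bform linearZ/= -!scalemxAl mxE. Qed.

Lemma bformZr A a u v : bform A u (a *: v) = a * bform A u v.
Proof. by rewrite /bform -scalemxAr mxE. Qed.

Lemma bformNl A u v : bform A (- u) v = - bform A u v.
Proof. by rewrite -scaleN1r bformZl mulN1r. Qed.

Lemma bformNr A u v : bform A u (- v) = - bform A u v.
Proof. by rewrite -scaleN1r bformZr mulN1r. Qed.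

Lemma bformC A u v : A^T = A -> bform A u v = bform A v u.
Proof.
move=> sA; rewrite /bform -[in LHS](trmxK (_ *m v)) mxE.
by rewrite !trmx_mul trmxK sA mulmxA.
Qed.

Definition bform_linE := (bformDl, bformDr, bformNl, bformNr, bformZl, bformZr).

Lemma bform_delta A k l : bform A (delta_mx k 0) (delta_mx l 0) = A k l.
Proof.
rewrite /bform trmx_delta -rowE -colE !mxE.
by [].
Qed.

(* Only quadratic forms shifted by u occur on the right, so the diagonal of W^-1
   inherits measurability from q_g (with u the mean), although neither the mean
   nor W is assumed measurable. *)
Lemma diag_by_polarization A u k :
  A k k = 2^-1 * (bform A (delta_mx k 0 - u) (delta_mx k 0 - u)
    + bform A (- delta_mx k 0 - u) (- delta_mx k 0 - u)
    - 2 * bform A (0 - u) (0 - u)).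
Proof. by rewrite sub0r !bform_linE bform_delta; field. Qed.

Definition psd A := A^T = A /\ forall v, 0 <= bform A v v.

(** The form of W^-1 at v is the form of W at W^-1 v. *)
Lemma psd_invmx W : W \in unitmx -> psd W -> psd (invmx W).
Proof.
move=> uW [sW pW]; have sV : (invmx W)^T = invmx W by rewrite trmx_inv sW.
split => // v; have := pW (invmx W *m v).
by rewrite /bform trmx_mul sV !mulmxA mulmxKV.
Qed.

(** With a, b, c the values of the form at (u, u), (v, v), (u, v), the difference is 2 c - b.
    Nonnegativity at e u + v and e u - v gives 2 |c| <= e a + b / e. *)
Lemma psd_perturb A u v (e : R) : psd A -> 0 < e ->
  `|bform A u u - bform A (u - v) (u - v)|
    <= e * bform A u u + (1 + e^-1) * bform A v v.
Proof.
move=> [sA pA] e0.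
have h1 := pA (e *: u + v); have h2 := pA (e *: u - v).
rewrite !bform_linE (bformC v u sA) in h1 h2 *.
set a := bform A u u in h1 h2 *; set b := bform A v v in h1 h2 *.
set c := bform A u v in h1 h2 *.
have b0 : 0 <= b by exact: pA.
have H x : e * x <= e * (e * a) + b -> x <= e * a + e^-1 * b.
  move=> h; rewrite -(ler_pM2l e0); apply: le_trans h _.
  by rewrite [leRHS]mulrDr (mulrA e e^-1) mulfV ?gt_eqF// mul1r.
have hp : 2 * c <= e * a + e^-1 * b by apply: H; lra.
have hn : - (2 * c) <= e * a + e^-1 * b by apply: H; lra.
by rewrite ler_norml; apply/andP; split; lra.
Qed.

(** Nonnegativity at v_i e_i - v_j e_j gives 2 v_i A_ij v_j <= v_i^2 A_ii + v_j^2 A_jj, to be summed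
    over i and j. Only diagonal entries remain, whose measurability is available. *)
Lemma psd_le_diag A v : psd A ->
  bform A v v <= L%:R * \sum_k v k 0 ^+ 2 * A k k.
Proof.
move=> [sA pA]; set D := \sum_k _.
have -> : L%:R * D = \sum_i \sum_j 2^-1 * (v i 0 ^+ 2 * A i i + v j 0 ^+ 2 * A j j).
  under eq_bigr do rewrite -mulr_sumr big_split/= sumr_const card_ord -[_ *+ L]mulr_natl.
  rewrite -mulr_sumr big_split/= -mulr_sumr sumr_const card_ord -[_ *+ L]mulr_natl.
  by rewrite -/D; field.
rewrite bformE; apply: ler_sum => i _; apply: ler_sum => j _.
have := pA (v i 0 *: delta_mx i 0 - v j 0 *: delta_mx j 0).
rewrite !bform_linE !bform_delta.
have -> : A j i = A i j by rewrite -[in LHS]sA mxE.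
lra.
Qed.

Lemma psd_diag_ge0 A k : psd A -> 0 <= A k k.
Proof. by move=> [_ /(_ (delta_mx k 0))]; rewrite bform_delta. Qed.

End quadratic_forms.

(** * Quantization and truncation of nonnegative numbers *)

Section truncation.
Context (R : realType).
Implicit Types x z k p : R.

(** The sum counts the multiples del, ..., N del that do not exceed z: the step function rounds z
    down to the mesh and is capped at N del. The error is the rounding plus the excess over the
    cap. *)
Lemma quantize (N : nat) (del z : R) : 0 < del -> 0 <= z ->
  `|z - del * \sum_(j < N) (j.+1%:R * del <= z)%R%:R|
    <= del + Num.max (z - N%:R * del) 0.
Proof.
move=> del0 z0; set S := del * _.
suff [h1 h2] : (N%:R * del <= z -> S = N%:R * del) /\
    (z < N%:R * del -> S <= z <= S + del).
  have [h|h] := leP (N%:R * del) z.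
    by rewrite (h1 h) ger0_norm ?subr_ge0// ler_wpDl ?(ltW del0)// le_max lexx.
  have /andP[? ?] := h2 h; rewrite ger0_norm ?subr_ge0//.
  apply: (@le_trans _ _ (del + 0)); first lra.
  by rewrite lerD2l le_max lexx orbT.
rewrite {}/S; elim: N => [|N [IH1 IH2]].
  rewrite big_ord0 mulr0 mul0r; split => // h; move: (lt_le_trans h z0).
  by rewrite ltxx.
rewrite big_ord_recr/= mulrDr; set S := del * _ in IH1 IH2 *.
rewrite -[in X in X * del](addn1 N) natrD mulrDl mul1r.
have [h|h] := leP (N%:R * del + del) z.
  split => // _.
  by rewrite IH1 ?mulr1//; apply: le_trans h; rewrite lerDl ltW.
split => // _.
rewrite mulr0 addr0; have [h'|h'] := leP (N%:R * del) z; last exact: IH2.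
by rewrite IH1// h' ltW.
Qed.

Lemma quantize_perturb (N : nat) (del z z' D : R) : 0 < del -> 0 <= z' ->
  `|z - z'| <= D ->
  `|z - del * \sum_(j < N) (j.+1%:R * del <= z')%R%:R|
    <= 2 * D + (del + Num.max (z - N%:R * del) 0).
Proof.
move=> del0 z'0 zz'; have := quantize N del0 z'0; set S := del * _ => h.
have h1 := ler_distD z' z S.
have h2 : Num.max (z' - N%:R * del) 0 <= D + Num.max (z - N%:R * del) 0.
  have D0 : 0 <= D by exact: le_trans (normr_ge0 _) zz'.
  rewrite ge_max; apply/andP; split; last by rewrite addr_ge0// le_max lexx orbT.
  apply: (@le_trans _ _ (D + (z - N%:R * del))); last by rewrite lerD2l le_max lexx.
  move: zz'; rewrite ler_norml => /andP[? ?]; lra.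
lra.
Qed.

(** Where z > k the factor (z / k)^(p - 1) is at least 1. A moment of order p > 1 thus makes the
    excess uniformly small in mean for large k. *)
Lemma excess_le_powR p k z : 1 < p -> 0 < k -> 0 <= z ->
  Num.max (z - k) 0 <= (k `^ (p - 1))^-1 * z `^ p.
Proof.
move=> p1 k0 z0; have K0 : 0 < k `^ (p - 1) by exact: powR_gt0.
rewrite ge_max mulr_ge0 ?invr_ge0 ?powR_ge0 ?(ltW K0)// andbT.
have [zk|kz] := leP z k.
  apply: (@le_trans _ _ 0); first by rewrite subr_le0.
  by rewrite mulr_ge0 ?invr_ge0// powR_ge0.
have zp : 0 < z by exact: lt_trans kz.
apply: (@le_trans _ _ z); first by rewrite gerBl ltW.
rewrite -[z `^ p]mulr_powRB1 ?(lt_trans ltr01 p1)// mulrCA ler_peMr//.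
by rewrite ler_pdivlMl// mulr1 ge0_ler_powR ?nnegrE ?subr_ge0 ?ltW.
Qed.

Lemma powR_le1D p q x : 0 <= x -> 0 <= q <= p -> x `^ q <= 1 + x `^ p.
Proof.
move=> x0 /andP[q0 qp]; have [x1|x1] := leP x 1.
  apply: (@le_trans _ _ (1 `^ q)); last by rewrite powR1 lerDl powR_ge0.
  by rewrite ge0_ler_powR ?nnegrE.
by apply: (@le_trans _ _ (x `^ p)); rewrite ?lerDr// ler_powR// ltW.
Qed.

End truncation.

(** * Measurability of matrix-valued variables and of the diagonal of W^-1 *)

Section matrix_measurability.
Context (R : realType).

Lemma measurable_mxR_coord (m n : nat) i j :
  measurable_fun setT (fun A : mxR R m n => (A : 'M[R]_(m, n)) i j).
Proof.
move=> _ B mB; rewrite setTI; apply: sub_sigma_algebra.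
by exists (i, j) => //; exists B => //; rewrite setTI.
Qed.

Lemma measurable_mxRP d (T : measurableType d) (m n : nat) (f : T -> mxR R m n) :
  measurable_fun setT f <->
  (forall i j, measurable_fun setT (fun w => (f w : 'M[R]_(m, n)) i j)).
Proof.
split=> [mf i j|mf]; first exact: measurableT_comp (measurable_mxR_coord i j) mf.
apply: (@measurability _ _ T (mxR R m n) setT f (@mx_cylinders R m n)) => //.
move=> _ [_ [ij _ [B mB <-]] <-].
by rewrite !setTI; have := mf ij.1 ij.2 measurableT _ mB; rewrite setTI.
Qed.

Context (L p q : nat) (m : 'M[R]_(L, p) -> 'rV[R]_p -> 'cV[R]_L)
  (W : 'M[R]_(L, p) -> 'rV[R]_p -> 'rV[R]_q -> 'M[R]_L)
  (theta : 'rV[R]_p) (gamma : 'rV[R]_q).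
Context (mq : measurable_fun setT (fun z : mxR R L p * mxR R L 1 =>
  q_fun m W z.1 z.2 theta gamma)).

Lemma measurable_q_fun d (T : measurableType d) (x : T -> mxR R L p)
    (y : T -> mxR R L 1) :
  measurable_fun setT x -> measurable_fun setT y ->
  measurable_fun setT (fun w => q_fun m W (x w) (y w) theta gamma).
Proof.
move=> mx my; apply: (@measurableT_comp _ _ _ _ _ _ _ _ (fun w => (x w, y w)) mq).
exact: measurable_fun_pair.
Qed.

Lemma measurable_diag_invmx k : measurable_fun setT (fun x : mxR R L p =>
  invmx (W x theta gamma) k k).
Proof.
pose qq u (x : mxR R L p) := q_fun m W x u theta gamma.
have mqq u : measurable_fun setT (qq u).
  by apply: measurable_q_fun => //; exact: measurable_cst.
rewrite (_ : (fun x => _) = fun x => 2^-1 * (qq (delta_mx k 0) x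
    + qq (- delta_mx k 0) x - 2 * qq 0 x)); last first.
  by apply/funext => x; rewrite (diag_by_polarization _ (m x theta)).
apply: measurable_funM => //; apply: measurable_funB; last exact: measurable_funM.
exact: measurable_funD.
Qed.

End matrix_measurability.

(** * Measurability with respect to the innovations at a set of sites *)

Section eps_measurability.
Context (R : realType) (dO : measure_display) (Om : measurableType dO)
  (dE : measure_display) (E : measurableType dE)
  (d L p q : nat) (M : gee_array R Om E d L p q) (G : nat).
Implicit Types (U V : set 'rV[R]_d).

(** Taking the generated sigma-algebra as a measurable structure on [Om] turns dependence on the
    innovations in U into ordinary measurability, with all its closure lemmas. *)
Definition eps_space U := g_sigma_algebraType
  (\bigcup_(i in U) preimage_set_system setT (eps M G i) measurable).

Lemma measurable_eps_spaceP d' (T : measurableType d') U (f : Om -> T) :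
  measurable_fun (setT : set (eps_space U)) f <->
  (forall B, measurable B -> sigma_eps M G U (f @^-1` B)).
Proof.
split=> [mf B mB|mf _ B mB]; last by rewrite setTI; exact: mf.
by have := mf measurableT _ mB; rewrite setTI.
Qed.

Lemma sigma_epsS U V : U `<=` V -> sigma_eps M G U `<=` sigma_eps M G V.
Proof. by move=> UV; apply: sub_sigma_algebra2; exact: bigcup_subset. Qed.

Lemma sigma_eps_measurable U : sigma_eps M G U `<=` measurable.
Proof.
apply: smallest_sub; first exact: sigma_algebra_measurable.
move=> _ [i _ [B mB <-]].
have : measurable_fun setT (eps M G i) by exact: measurable_fun_pair.
by apply.
Qed.

Lemma measurable_xrv_eps U i : U i ->
  measurable_fun (setT : set (eps_space U)) (xrv M G i).
Proof.
move=> Ui; have me : measurable_fun (setT : set (eps_space U)) (eps M G i).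
  apply/measurable_eps_spaceP => B mB; apply: sub_sigma_algebra.
  by exists i => //; exists B => //; rewrite setTI.
exact: (measurableT_comp measurable_fst me).
Qed.

Lemma measurable_xg_eps U (g : 'I_G) : (forall l, U (site M g l)) ->
  measurable_fun (setT : set (eps_space U)) (xg M g : Om -> mxR R L p).
Proof.
move=> Ug; apply/measurable_mxRP => l k.
rewrite (_ : (fun w => _) = fun w => (xrv M G (site M g l) w : 'rV[R]_p) 0 k).
  exact: (iffLR (measurable_mxRP _) (measurable_xrv_eps (Ug l))).
by apply/funext => w; rewrite mxE.
Qed.

Lemma measurable_xg (g : 'I_G) :
  measurable_fun setT (xg M g : Om -> mxR R L p).
Proof.
apply/measurable_mxRP => l k.
rewrite (_ : (fun w => _) = fun w => (xrv M G (site M g l) w : 'rV[R]_p) 0 k).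
  by apply: (iffLR (measurable_mxRP _)).
by apply/funext => w; rewrite mxE.
Qed.

Lemma measurable_yg (g : 'I_G) :
  measurable_fun setT (yg M g : Om -> mxR R L 1).
Proof.
apply/measurable_mxRP => l k.
rewrite (_ : (fun w => _) = yrv M G (site M g l)) => [//|].
by apply/funext => w; rewrite mxE.
Qed.

End eps_measurability.

(** * Moment bounds as L_1 bounds *)

Section moments.
Context (R : realType) (dO : measure_display) (Om : measurableType dO)
  (P : probability Om R).

(* The upper function, a supremum over the parameter space, need not be
   measurable. *)
Lemma ge0_le_integral_lower (f g : Om -> \bar R) : measurable_fun setT f ->
  (forall w, 0 <= f w)%E -> (forall w, f w <= g w)%E ->
  (\int[P]_w f w <= \int[P]_w g w)%E.
Proof.
move=> mf f0 fg; have g0 w : (0 <= g w)%E by exact: le_trans (fg w).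
rewrite !ge0_integralTE//; apply: le_ereal_sup => _ [h hf <-].
by exists h => // w; apply: le_trans (hf w) (fg w).
Qed.

Lemma L1_le_moment (r c : R) (f : Om -> R) : measurable_fun setT f ->
  (moment P r f <= c%:E)%E -> L1_le P (fun w => `|f w| `^ r) c.
Proof.
move=> mf fc; split.
  apply: (@measurableT_comp _ _ _ _ _ _ (@powR R ^~ r)); first exact: measurable_powR.
  exact: measurableT_comp.
by under eq_integral => w _ do rewrite ger0_norm ?powR_ge0//.
Qed.

Lemma L1_le_sup_moment (T : Type) (S : set T) (r c : R) (f : T -> Om -> R) a :
  measurable_fun setT (f a) -> S a ->
  (sup_moment P r S f <= c%:E)%E -> L1_le P (fun w => `|f a w| `^ r) c.
Proof.
move=> mf Sa fc; apply: L1_le_moment => //; apply: le_trans fc.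
apply: ge0_le_integral_lower => [|w|w]; last by apply: ereal_sup_ubound; exists a.
  apply/measurable_EFinP.
  apply: (@measurableT_comp _ _ _ _ _ _ (@powR R ^~ r)); first exact: measurable_powR.
  exact: measurableT_comp.
by rewrite lee_fin powR_ge0.
Qed.

Lemma L1_le_Lnorm4 (f : Om -> R) c : measurable_fun setT f ->
  (Lnorm P 4%:E (EFin \o f) < c%:E)%E -> 0 < c /\ L1_le P (fun w => f w ^+ 4) (c ^+ 4).
Proof.
move=> mf fc; have N0 := Lnorm_ge0 P 4%:E (EFin \o f).
have c0 : 0 < c by rewrite -lte_fin; exact: le_lt_trans fc.
split => //; split; first by apply: measurable_funX.
have four : (4 : R) != 0 by [].
have := poweR_Lnorm P (EFin \o f) four.
under eq_integral => w _ do rewrite /= powR_mulrn// -normrX.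
move=> <-; move: N0 fc; case: (Lnorm _ _ _) => // n; rewrite lee_fin lte_fin => n0 nc.
rewrite poweR_EFin powR_mulrn// lee_fin lerXn2r ?nnegrE// ltW//.
Qed.

End moments.

(** * Decorrelation of distant groups *)

Section decorrelation.
Context (R : realType) (dO : measure_display) (Om : measurableType dO)
  (P : probability Om R) (dE : measure_display) (E : measurableType dE)
  (d L p q : nat) (M : gee_array R Om E d L p q).

(** These sites carry the innovations on which the approximated contribution of group g depends. *)
Definition enlarge (s G : nat) (g : 'I_G) : set 'rV[R]_d :=
  [set j | Tsites M G j /\ exists l, rho (site M g l) j <= s%:R].

(** Separation bounds the size of an enlarged group by some u free of G and g, so the mixing bound
    at sizes (u, u) tends to 0 with r and falls below k at some fixed r. *)
Lemma enlarged_groups_decorrelated (tau : R) (ahat : nat -> R) (s : nat) (k : R) :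
  sampling_scheme M -> A1 M ->
  (forall u v r : nat,
    (alpha_bar P M u v r%:R <= ((u + v)%:R `^ tau * ahat r)%:E)%E) ->
  ahat @ \oo --> (0 : R) -> 0 < k ->
  exists C (near : forall G, rel 'I_G), forall G (g : 'I_G),
    (#|near G g| <= C)%N /\ forall h A B, ~~ near G g h ->
      sigma_eps M G (enlarge s g) A -> sigma_eps M G (enlarge s h) B ->
      (`|P (A `&` B) - P A * P B| <= k%:E)%E.
Proof.
move=> samp [_ _ [rho0 rho01 sep]] mix ahat0 k0.
have sepM i j : lattice M i -> lattice M j -> i <> j -> 1 < rho i j.
  by move=> Mi Mj ij; apply: lt_le_trans rho01 (sep _ _ Mi Mj ij).
pose u := #|{: option 'I_L * {ffun 'I_d -> 'I_s.*2.+1}}|.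
pose c : R := (u + u)%:R `^ tau.
have c0 : 0 <= c by exact: powR_ge0.
have c1 : 0 < c + 1 by rewrite ltr_wpDl.
have [r ahr] : exists r, c * ahat r <= k.
  have kc : 0 < k / (c + 1) by rewrite divr_gt0.
  move/cvgrPdist_le : ahat0 => /(_ _ kc) [r _ /(_ r (leqnn _))] /=.
  rewrite sub0r normrN => /(le_trans (ler_norm _)) h; exists r.
  apply: (@le_trans _ _ (c * (k / (c + 1)))); first by rewrite ler_wpM2l.
  by rewrite mulrA ler_pdivrMr// mulrDr mulr1 mulrC lerDl ltW.
(* Two enlargements by s and a gap r: by the triangle inequality, groups without members within n of
   each other have enlargements at distance at least r. *)
pose n := (s + s + r)%N.
pose near G : rel 'I_G := fun g h =>
  [exists l, exists k, rho (site M g l) (site M h k) <= n%:R].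
exists #|{: option ('I_L * 'I_L) * {ffun 'I_d -> 'I_n.*2.+1}}|, near => G g.
have [site_inj _ DT TM] := samp G.
have siteT (h : 'I_G) l : Tsites M G (site M h l) by apply: DT; exists h => //; exists l.
split.
  apply: (card_near_groups sepM) => [h l|h h' l l' /site_inj[]//].
  by apply: TM; exact: siteT.
move=> h A B gh sA sB.
have cardU (g' : 'I_G) : (enlarge s g' #<= `I_u)%card.
  apply: card_le_trans (card_neighbours sepM _ (site M g')).
  by apply: subset_card_le => j [Tj ?]; split => //; exact: TM.
have abar : (alpha_bar P M u u r%:R <= k%:E)%E.
  by apply: le_trans (mix u u r) _; rewrite lee_fin.
apply: le_trans abar; apply: (@le_trans _ _ (alpha P (sigma_eps M G (enlarge s g))
    (sigma_eps M G (enlarge s h)))).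
  by apply: ereal_sup_ubound; exists A, B.
apply: ereal_sup_ubound; exists G, (enlarge s g), (enlarge s h); split => //.
- by move=> j [].
- by move=> j [].
apply: le_ereal_inf_tmp => _ [i [j [[_ [l il]] [_ [l' jl']] ->]]].
rewrite lee_fin leNgt; apply/negP => ij.
move: gh; rewrite negb_exists => /forallP/(_ l); rewrite negb_exists => /forallP/(_ l').
rewrite -ltNge ltNge => /negP; apply.
apply: (@le_trans _ _ (rho (site M g l) i + rho i j + rho (site M h l') j)).
  rewrite /rho (distrC j (site M h l')).
  have h1 := ler_distD j (site M h l') (site M g l).
  by have h2 := ler_distD i j (site M g l); lra.
by rewrite !natrD; lra.
Qed.

End decorrelation.

(** * Approximation of one contribution by a step function *)

Section group_approximation.
Context (R : realType) (dO : measure_display) (Om : measurableType dO)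
  (P : probability Om R) (dE : measure_display) (E : measurableType dE)
  (d L p q : nat) (M : gee_array R Om E d L p q).

Lemma dned_le_d_g G (g : 'I_G) l : dned M G (site M g l) <= d_g M g.
Proof. by rewrite /d_g; exact: (le_bigmax _ (fun l => dned M G (site M g l)) l). Qed.

Lemma d_g_le_M G (g : 'I_G) : d_g M g <= M_ M G.
Proof.
apply: (@le_trans _ _ (Num.max (d_g M g) (c_g M g))); first by rewrite le_max lexx.
exact: (le_bigmax _ (fun g : 'I_G => Num.max (d_g M g) (c_g M g)) g).
Qed.

Lemma cq_le_M G (g : 'I_G) : cq M g <= M_ M G.
Proof.
apply: (@le_trans _ _ (Num.max (d_g M g) (c_g M g))).
  by rewrite le_max /c_g le_max lexx orbT.
exact: (le_bigmax _ (fun g : 'I_G => Num.max (d_g M g) (c_g M g)) g).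
Qed.

Context (Theta : set 'rV[R]_p) (Gamma : set 'rV[R]_q) (theta : 'rV[R]_p)
  (gamma : 'rV[R]_q).
Context (G : nat) (g : 'I_G).
Let A w := invmx (wcov M g (xg M g w) theta gamma).
Let mu w := mean M g (xg M g w) theta.
Let Z w := q_g M g theta gamma w / M_ M G.
Context (p'' C r C2 Kd ps : R) (h : 'I_L -> Om -> R).
Let Z' w := q_fun (mean M g) (wcov M g) (xg M g w) (\col_l h l w) theta gamma / M_ M G.
Context
  (mq : measurable_fun setT (fun z : mxR R L p * mxR R L 1 =>
      q_fun (mean M g) (wcov M g) z.1 z.2 theta gamma))
  (psdA : forall w, psd (A w))
  (p1 : 1 < p'') (r2 : 2 <= r) (cq0 : 0 < cq M g) (dg0 : 0 < d_g M g)
  (dgK : d_g M g <= Kd) (ps0 : 0 < ps)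
  (Vq : L1_le P (fun w => `|q_g M g theta gamma w / cq M g| `^ p'') C)
  (VA : forall k, L1_le P (fun w => `|A w k k| `^ r) C2)
  (mh : forall l, measurable_fun setT (h l))
  (Vh : forall l, L1_le P (fun w => (yrv M G (site M g l) w - h l w) ^+ 4)
      ((d_g M g * ps) ^+ 4)).

Let M0 : 0 < M_ M G := lt_le_trans dg0 (d_g_le_M g).

Let Z_ge0 w : 0 <= Z w.
Proof. by rewrite divr_ge0 ?(ltW M0)//; exact: (psdA w).2. Qed.

Let Z'_ge0 w : 0 <= Z' w.
Proof. by rewrite divr_ge0 ?(ltW M0)//; exact: (psdA w).2. Qed.

Let mZ : measurable_fun setT Z.
Proof.
apply: measurable_funM => //.
by apply: (measurable_q_fun mq); [exact: measurable_xg|exact: measurable_yg].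
Qed.

Let mZ' : measurable_fun setT Z'.
Proof.
apply: measurable_funM => //.
apply: (measurable_q_fun mq); first exact: measurable_xg.
apply/measurable_mxRP => l k.
rewrite (_ : (fun w => _) = h l) => [//|].
by apply/funext => w; rewrite mxE.
Qed.

Let Z_le w : Z w <= `|q_g M g theta gamma w / cq M g|.
Proof.
have q0 : 0 <= q_g M g theta gamma w by exact: (psdA w).2.
rewrite ger0_norm ?divr_ge0 ?(ltW cq0)// ler_wpM2l// lef_pV2 ?posrE//.
exact: cq_le_M.
Qed.

(** The mean is bounded through z <= 1 + z^p'', where z = |q_g / cq| dominates Z because cq <=
    M_G. *)
Let LZ : L1_le P Z (1 + C).
Proof.
have := L1_leD (L1_le_cst P 1) Vq; rewrite normr1 => H.
apply: (L1_le_dom mZ H) => w; rewrite ger0_norm//.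
apply: le_trans (ler_norm _); apply: le_trans (Z_le w) _.
rewrite -[leLHS]powRr1//; apply: powR_le1D => //.
by rewrite ler01 ltW.
Qed.

Let l := (d_g M g * ps) ^+ 2.
Let l0 : 0 < l. Proof. by rewrite exprn_gt0// mulr_gt0. Qed.

(* AM-GM: 2 v^2 a <= v^4 / l + l a^2, where the weight l balances the two terms. *)
Let F k w := l^-1 * (yrv M G (site M g k) w - h k w) ^+ 4 + l * (1 + `|A w k k| `^ r).

Let F_ge k w : 2 * ((yrv M G (site M g k) w - h k w) ^+ 2 * A w k k) <= F k w.
Proof.
rewrite /F; set v := _ - _; set a := A w k k.
have a0 : 0 <= a by exact: psd_diag_ge0.
have a2 : a ^+ 2 <= 1 + `|a| `^ r.
  by rewrite -powR_mulrn// ger0_norm//; apply: powR_le1D; rewrite ?ler0n.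
apply: (@le_trans _ _ (l^-1 * v ^+ 4 + l * a ^+ 2)); last first.
  by rewrite lerD2l ler_wpM2l// ltW.
have -> : l^-1 * v ^+ 4 + l * a ^+ 2 =
    2 * (v ^+ 2 * a) + l^-1 * (v ^+ 2 - l * a) ^+ 2.
  by field; rewrite gt_eqF.
by rewrite lerDl mulr_ge0 ?sqr_ge0// invr_ge0 ltW.
Qed.

Let Delta w := L%:R / (2 * M_ M G) * \sum_k F k w.
Let B := L%:R ^+ 2 / 2 * (Kd * ps ^+ 2 * (2 + C2)).

(** Both terms of [F] have mean of order l = (d_g ps)^2. Dividing by M_G >= d_g leaves at most Kd
    ps^2, which vanishes with ps uniformly over the array. *)
Let LDelta : (0 < L)%N -> L1_le P Delta B.
Proof.
move=> L0; have C20 : 0 <= C2 by exact: (L1_le_ge0 (VA (Ordinal L0))).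
have LF k : L1_le P (F k) (l * (2 + C2)).
  have := L1_leD (L1_leZ l^-1 (Vh k)) (L1_leZ l (L1_leD (L1_le_cst P 1) (VA k))).
  apply: L1_le_weaken; rewrite normr1 !gtr0_norm ?invr_gt0//.
  have -> : (d_g M g * ps) ^+ 4 = l * l by rewrite /l -exprD.
  by rewrite mulrA mulVf ?gt_eqF// mul1r; lra.
have := L1_leZ (L%:R / (2 * M_ M G)) (L1_le_sum LF).
have LM0 : 0 <= L%:R / (2 * M_ M G) by rewrite divr_ge0// mulr_ge0// ltW.
apply: L1_le_weaken; rewrite ger0_norm// sumr_const card_ord -[(_ * _) *+ L]mulr_natl.
have -> : L%:R / (2 * M_ M G) * (L%:R * (l * (2 + C2))) =
    L%:R ^+ 2 / 2 * (l / M_ M G * (2 + C2)) by field; rewrite gt_eqF.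
apply: ler_wpM2l; first by rewrite divr_ge0 ?sqr_ge0.
apply: ler_wpM2r; first by rewrite addr_ge0.
rewrite ler_pdivrMr// /l exprMn [leRHS]mulrAC ler_pM2r ?exprn_gt0// expr2.
by apply: ler_pM; rewrite ?(ltW dg0)//; exact: d_g_le_M.
Qed.

(** The mean and W depend on x_g alone and are the same in Z and Z', so [psd_perturb] applies with v
    = y - h; [psd_le_diag] and [F_ge] then bound the form at v. *)
Let ZZ' (e : R) w : 0 < e -> `|Z w - Z' w| <= e * Z w + (1 + e^-1) * Delta w.
Proof.
move=> e0; pose u := yg M g w - mu w; pose v := \col_k (yrv M G (site M g k) w - h k w).
have uv : u - v = (\col_k h k w) - mu w.
  by apply/matrixP => i j; rewrite !mxE; ring.
have H := psd_perturb u v (psdA w) e0; rewrite uv in H.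
have H2 : bform (A w) v v / M_ M G <= Delta w.
  rewrite ler_pdivrMr//; apply: le_trans (psd_le_diag v (psdA w)) _.
  rewrite /Delta.
  have -> : L%:R / (2 * M_ M G) * (\sum_k F k w) * M_ M G =
     L%:R * (\sum_k 2^-1 * F k w) by rewrite -mulr_sumr; field; rewrite gt_eqF.
  apply: ler_wpM2l => //; apply: ler_sum => k _; rewrite !mxE.
  by rewrite ler_pdivlMl//; exact: F_ge.
rewrite /Z /Z' -mulrBl normrM [X in _ * X]gtr0_norm ?invr_gt0//.
apply: (@le_trans _ _ ((e * bform (A w) u u + (1 + e^-1) * bform (A w) v v) / M_ M G)).
  by rewrite ler_pM2r ?invr_gt0.
rewrite mulrDl -!mulrA lerD2l ler_wpM2l// addr_ge0// invr_ge0 ltW//.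
Qed.

(** Each error is controlled by a parameter of its own: the relative perturbation by e, then [B] by
    ps once e is fixed, the rounding by del and the truncation by N. *)
Lemma group_approximation (N : nat) (del e : R) : (0 < L)%N -> (0 < N)%N ->
  0 < del -> 0 < e ->
  L1_le P (fun w => Z w - del * \sum_(j < N)
      (\1_[set v | (j.+1%:R * del <= Z' v)%R] w : R))
    (2 * (e * (1 + C) + (1 + e^-1) * B)
     + (del + ((N%:R * del) `^ (p'' - 1))^-1 * C)).
Proof.
move=> L0 N0 del0 e0.
have K0 : 0 < N%:R * del by rewrite mulr_gt0// ltr0n.
have K1 : 0 <= ((N%:R * del) `^ (p'' - 1))^-1 by rewrite invr_ge0 powR_ge0.
have e1 : 0 <= 1 + e^-1 by rewrite addr_ge0// invr_ge0 ltW.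
have LD := L1_leD (L1_leZ e LZ) (L1_leZ (1 + e^-1) (LDelta L0)).
have LE := L1_leD (L1_le_cst P del) (L1_leZ ((N%:R * del) `^ (p'' - 1))^-1 Vq).
have LW := L1_leD (L1_leZ 2 LD) LE.
rewrite !ger0_norm ?(ltW e0) ?(ltW del0)// in LW.
have ZE : (fun w => Z w - del * \sum_(j < N)
      (\1_[set v | (j.+1%:R * del <= Z' v)%R] w : R)) =
    fun w => Z w - del * \sum_(j < N) (j.+1%:R * del <= Z' w)%R%:R.
  apply/funext => w; congr (_ - _ * _); apply: eq_bigr => j _.
  rewrite indicE; congr (_%:R); congr nat_of_bool.
  by apply/idP/idP => [/set_mem//|?]; exact/mem_set.
apply: (L1_le_dom _ LW) => [|w].
  apply: measurable_funB => //; apply: measurable_funM => //.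
  apply: measurable_sum => j; apply: measurable_indic. exact: measurable_ge_set.
have -> := congr1 (fun f => f w) ZE.
apply: le_trans (quantize_perturb N del0 (Z'_ge0 w) (ZZ' w e0)) _.
apply: le_trans (ler_norm _); rewrite lerD2l lerD2l.
apply: le_trans (excess_le_powR p1 K0 (Z_ge0 w)) _; rewrite ler_wpM2l//.
rewrite ge0_ler_powR ?nnegrE ?Z_ge0//.
by rewrite ltW// (lt_trans ltr01).
Qed.

End group_approximation.

(** * The weak law for the contributions to the criterion *)

Section criterion_weak_law.
Context (R : realType) (dO : measure_display) (Om : measurableType dO)
  (P : probability Om R) (dE : measure_display) (E : measurableType dE)
  (d L p q : nat) (M : gee_array R Om E d L p q)
  (Theta : set 'rV[R]_p) (Gamma : set 'rV[R]_q).

Lemma working_covariance_psd G (g : 'I_G) theta gamma w :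
  working_covariance M Theta Gamma -> Theta theta -> Gamma gamma ->
  psd (invmx (wcov M g (xg M g w) theta gamma)).
Proof.
by move=> wc Tt Gg; have [sV pV uV] := wc G g w theta gamma Tt Gg; exact: psd_invmx.
Qed.

Lemma contributions_weak_law (psi : nat -> R) (tau : R) (ahat : nat -> R) theta gamma :
  (0 < L)%N ->
  sampling_scheme M -> working_covariance M Theta Gamma -> A1 M ->
  A2 P M psi tau ahat -> A4 P M Theta Gamma -> A5 P M Theta Gamma ->
  Theta theta -> Gamma gamma ->
  forall e : R, 0 < e -> \forall G \near \oo,
    L1_le P (fun w => G%:R^-1 * \sum_(g < G) (q_g M g theta gamma w / M_ M G
      - \int[P]_w (q_g M g theta gamma w / M_ M G))) e.
Proof.
move=> L0 samp wc hA1 [[[psi0 psilim dned0 ned] [Kd dnedK]] _ _ mix [ahat0 _]].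
move=> [meas _ _ _] [r [p' [p'' [p'1 p''1 rp [mom _ [scale0 scales _]]]]]] Tt Gg.
have [C1 [C2 [C3 [C4 moms]]]] := mom.
have [C qmom] := scales _ _ Tt Gg.
have r2 : 2 <= r.
  apply: le_trans (ltW rp); rewrite le_max; apply/orP; left; lra.
have site_D G (g : 'I_G) l : Dsites M G (site M g l) by exists g => //; exists l.
have d_g0 G (g : 'I_G) : 0 < d_g M g.
  by apply: lt_le_trans (dned_le_d_g M g (Ordinal L0)); exact: dned0.
have d_gK G (g : 'I_G) : d_g M g <= `|Kd|.
  (* The maximum [d_g] starts from 0, so its bound has to be nonnegative; hence |Kd|. *)
  apply/bigmax_leP; split => // l _.
  exact: le_trans (dnedK _ _ (site_D G g l)) (ler_norm _).
apply: (@weak_law_of_approximations _ _ _ P (fun G (g : 'I_G) w =>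
  q_g M g theta gamma w / M_ M G)) => e e0.
(* Four errors are to be at most e / 4 each; this eta makes 2 eta (1 + |C|) equal to e / 4. *)
pose eta := e / (8 * (1 + `|C|)).
have C1' : 0 < 1 + `|C| by rewrite ltr_pwDl.
have eta0 : 0 < eta by rewrite divr_gt0// mulr_gt0.
pose del := e / 4.
have del0 : 0 < del by rewrite divr_gt0.
(* The truncation error is at most |C| / K once (N del)^(p'' - 1) reaches K, and this K makes it at
   most e / 4. *)
pose K := 4 * (1 + `|C|) / e.
have K0 : 0 < K by rewrite divr_gt0// mulr_gt0.
have p10 : p'' - 1 != 0 by rewrite subr_eq0 gt_eqF.
pose N := (Num.truncn (K `^ (p'' - 1)^-1 / del)).+1.
have NK : K <= (N%:R * del) `^ (p'' - 1).
  have -> : K = (K `^ (p'' - 1)^-1) `^ (p'' - 1).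
    by rewrite -powRrM mulVf// powRr1// ltW.
  rewrite ge0_ler_powR ?nnegrE ?powR_ge0//; first by rewrite subr_ge0 ltW.
    by rewrite mulr_ge0// ltW.
  rewrite -ler_pdivrMr//; apply: ltW.
  by have /andP[] := truncn_itv (divr_ge0 (powR_ge0 K (p'' - 1)^-1) (ltW del0)).
pose B0 := L%:R ^+ 2 / 2 * (`|Kd| * (2 + `|C2|)).
have B00 : 0 <= B0.
  by rewrite mulr_ge0 ?divr_ge0 ?sqr_ge0// mulr_ge0// addr_ge0.
(* The coefficient of (psi s)^2 in the remaining error. Choosing psi s <= 1 below reduces the square
   to psi s. *)
pose D := 2 * (1 + eta^-1) * B0.
have D0 : 0 <= D.
  by rewrite !mulr_ge0// addr_ge0// invr_ge0 ltW.
have D1 : 0 < D + 1 by rewrite ltr_wpDl.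
have [s psis1 psise] : exists2 s, psi s <= 1 & psi s <= e / 4 / (D + 1).
  have m0 : 0 < Num.min 1 (e / 4 / (D + 1)).
    by rewrite lt_min ltr01/= !divr_gt0.
  move/cvgrPdist_le : psilim => /(_ _ m0) [s _ /(_ s (leqnn _))] /=.
  rewrite sub0r normrN => /(le_trans (ler_norm _)); rewrite le_min => /andP[? ?].
  by exists s.
have /choice [h hP] : forall x : {G : nat & ('I_G * 'I_L)%type}, exists h : Om -> R,
    let G := projT1 x in let i := site M (projT2 x).1 (projT2 x).2 in
    is_cond_exp P (sigma_eps M G [set j | Tsites M G j /\ rho i j <= s%:R])
      (yrv M G i) h /\
    (Lnorm P 4%:E (fun w => (yrv M G i w - h w)%:E) < (dned M G i * psi s)%:E)%E.
  move=> [G [g l]] /=; have [h h1 h2] := ned G _ s (site_D G g l).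
  by exists h.
pose hh G (g : 'I_G) l := h (existT (fun G => ('I_G * 'I_L)%type) G (g, l)).
pose Z' G (g : 'I_G) w := q_fun (mean M g) (wcov M g) (xg M g w)
  (\col_l hh G g l w) theta gamma / M_ M G.
exists N, del, (fun G g j => [set v | j.+1%:R * del <= Z' G g v]).
(* The step function involves x_g and the conditional expectations at the members of g; x_g is
   covered since each member lies in its own neighbourhood. *)
have sA G (g : 'I_G) (j : 'I_N) :
    sigma_eps M G (enlarge M s g) [set v | j.+1%:R * del <= Z' G g v].
  have [_ _ DT _] := samp G.
  have hm l : measurable_fun (setT : set (eps_space M G (enlarge M s g))) (hh G g l).
    apply/measurable_eps_spaceP => B mB.
    have [[mh _ _] _] := hP (existT (fun G => ('I_G * 'I_L)%type) G (g, l)).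
    by apply: (sigma_epsS _ (mh _ mB)) => i /= [Ti gi]; split => //; exists l.
  have mx : measurable_fun (setT : set (eps_space M G (enlarge M s g)))
      (xg M g : Om -> mxR R L p).
    apply: measurable_xg_eps => l; split; first by apply: DT; exact: site_D.
    by exists l; rewrite /rho subrr normr0.
  have my : measurable_fun (setT : set (eps_space M G (enlarge M s g)))
      ((fun w => \col_l hh G g l w) : Om -> mxR R L 1).
    apply/measurable_mxRP => l k.
    rewrite (_ : (fun w => _) = hh G g l) => [//|].
    by apply/funext => w; rewrite mxE.
  have [mq _ _] := meas G g _ _ Tt Gg.
  have mZ : measurable_fun (setT : set (eps_space M G (enlarge M s g))) (Z' G g).
    by apply: measurable_funM => //; exact: (measurable_q_fun mq mx my).
  exact: measurable_ge_set mZ.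
split.
- by move=> G g j; exact: sigma_eps_measurable (sA G g j).
- move=> G g; have [mq _ _] := meas G g _ _ Tt Gg.
  (* The coefficients are only assumed nonnegative; the strict NED bound on a nonnegative norm makes
     this one positive. *)
  have psis0 : 0 < psi s.
    have [_ hn] := hP (existT (fun G => ('I_G * 'I_L)%type) G (g, Ordinal L0)).
    have := le_lt_trans (Lnorm_ge0 _ _ _) hn; rewrite lte_fin /= pmulr_rgt0//.
    exact: dned0.
  have mqg : measurable_fun setT (q_g M g theta gamma).
    by apply: (measurable_q_fun mq); [exact: measurable_xg|exact: measurable_yg].
  have mA k : measurable_fun setT (fun w => invmx (wcov M g (xg M g w) theta gamma) k k).
    exact: (@measurableT_comp _ _ _ _ _ _ _ _ (xg M g : Om -> mxR R L p)
      (measurable_diag_invmx mq k) (measurable_xg M g)).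
  have mh l : measurable_fun setT (hh G g l).
    move=> _ B mB; rewrite setTI.
    have [[mh _ _] _] := hP (existT (fun G => ('I_G * 'I_L)%type) G (g, l)).
    exact: sigma_eps_measurable (mh _ mB).
  have Vq : L1_le P (fun w => `|q_g M g theta gamma w / cq M g| `^ p'') `|C|.
    apply: (L1_le_weaken (ler_norm C)); apply: L1_le_moment.
      exact: measurable_funM.
    by have [] := qmom G g.
  have VA k : L1_le P
      (fun w => `|invmx (wcov M g (xg M g w) theta gamma) k k| `^ r) `|C2|.
    apply: (L1_le_weaken (ler_norm C2)); have [_ h2 _ _] := moms G g k k.
    by apply: (@L1_le_sup_moment _ _ _ P _ _ r C2 (w_entry M g k k) (theta, gamma)
      (mA k) _ h2).
  have Vh l : L1_le P (fun w => (yrv M G (site M g l) w - hh G g l w) ^+ 4)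
      ((d_g M g * psi s) ^+ 4).
    have [_ hn] := hP (existT (fun G => ('I_G * 'I_L)%type) G (g, l)).
    have mf : measurable_fun setT (fun w => yrv M G (site M g l) w - hh G g l w).
      by apply: measurable_funB => //; exact: mh.
    have [c0 h4] := L1_le_Lnorm4 mf hn.
    apply: L1_le_weaken h4; rewrite lerXn2r ?nnegrE//; first exact: ltW.
      by rewrite mulr_ge0// ltW.
    by apply: ler_wpM2r; [exact: ltW|exact: dned_le_d_g].
  have [cq0 _ _] := scale0 G g.
  have := group_approximation mq (fun w => working_covariance_psd g w wc Tt Gg)
    p''1 r2 cq0 (d_g0 G g) (d_gK G g) psis0 Vq VA mh Vh L0
    (ltn0Sn _ : (0 < N)%N) del0 eta0.
  apply: L1_le_weaken.
  have b1 : 2 * (eta * (1 + `|C|)) = e / 4.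
    by rewrite /eta; field; rewrite gt_eqF.
  have b2 : 2 * ((1 + eta^-1) *
      (L%:R ^+ 2 / 2 * (`|Kd| * psi s ^+ 2 * (2 + `|C2|)))) <= e / 4.
    rewrite [leLHS](_ : _ = D * psi s ^+ 2); last by rewrite /D /B0; ring.
    apply: (@le_trans _ _ ((D + 1) * psi s)); last first.
      by rewrite mulrC -ler_pdivlMr.
    apply: ler_pM; rewrite ?sqr_ge0//; first by rewrite lerDl.
    by rewrite expr2 ler_piMr// ltW.
  have b3 : ((N%:R * del) `^ (p'' - 1))^-1 * `|C| <= e / 4.
    have NK0 := lt_le_trans K0 NK.
    rewrite mulrC ler_pdivrMr//; apply: (@le_trans _ _ (e / 4 * K)).
      have -> : e / 4 * K = 1 + `|C| by rewrite /K; field; rewrite gt_eqF.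
      by rewrite lerDr.
    by rewrite ler_wpM2l// ltW.
  rewrite mulrDr b1 /del; lra.
- move=> k k0.
  have [C' [near nearP]] := enlarged_groups_decorrelated s samp hA1 mix ahat0 k0.
  exists C', near => G g; have [h1 h2] := nearP G g; split => // g' j i gg'.
  exact: h2 gg' (sA G g j) (sA G g' i).
Qed.

End criterion_weak_law.

(** * The Euclidean metric on the parameters *)

Section parameter_metric.
Context (R : realType).

Lemma l2norm_ge0 (m n : nat) (A : 'M[R]_(m, n)) : 0 <= l2norm A.
Proof. exact: sqrtr_ge0. Qed.

Lemma nuC (p : nat) (a b : 'rV[R]_p) : nu a b = nu b a.
Proof.
congr Num.sqrt; apply: eq_bigr => i _; apply: eq_bigr => j _.
by rewrite !mxE -sqrrN opprB.
Qed.

Lemma nu_le_nu2 (p q : nat) (a b : 'rV[R]_p * 'rV[R]_q) : nu a.1 b.1 <= nu2 a b.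
Proof.
rewrite /nu2 /nu /l2norm opp_row_mx add_row_mx ler_sqrt; last first.
  by do 2 (apply: sumr_ge0 => ? _); exact: sqr_ge0.
apply: ler_sum => i _; rewrite big_split_ord/= -[leLHS]addr0; apply: lerD.
  by apply: ler_sum => j _; rewrite row_mxEl.
by apply: sumr_ge0 => j _; exact: sqr_ge0.
Qed.

(** The topology comes from max norms. Coordinates below e / n give a sum of squares below n (e /
    n)^2 <= e^2; the 1 in n gives strictness and covers p + q = 0. *)
Lemma nu2_near (p q : nat) (a : 'rV[R]_p * 'rV[R]_q) (e : R) : 0 < e ->
  \forall b \near a, nu2 a b < e.
Proof.
move=> e0; pose n : R := (p + q)%:R + 1.
have n0 : 0 < n by rewrite ltr_wpDl.
have del0 : 0 < e / n by rewrite divr_gt0.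
near=> b.
have [b1 b2] : ball a (e / n) b by near: b; exact: nbhsx_ballx.
rewrite -ball_normE in b1; rewrite -ball_normE in b2.
have sq x : `|x| < e / n -> x ^+ 2 <= (e / n) ^+ 2.
  by move=> /ltW xe; rewrite -(real_normK (num_real x)) lerXn2r ?nnegrE// ltW.
rewrite /nu2 /nu /l2norm opp_row_mx add_row_mx.
rewrite -[ltRHS]ger0_norm ?(ltW e0)// -sqrtr_sqr ltr_sqrt ?exprn_gt0//.
rewrite big_ord1; apply: (@le_lt_trans _ _ (\sum_(j < p + q) (e / n) ^+ 2)).
  apply: ler_sum => j _; apply: sq; case: (split_ordP j) => k ->.
    by rewrite row_mxEl; exact: le_lt_trans (ler_coord_mx_norm _ _ _) b1.
  by rewrite row_mxEr; exact: le_lt_trans (ler_coord_mx_norm _ _ _) b2.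
rewrite sumr_const card_ord -[_ *+ (p + q)%N]mulr_natl.
have -> : e ^+ 2 = n * (n * (e / n) ^+ 2) by field; rewrite gt_eqF.
apply: (@lt_le_trans _ _ (n * (e / n) ^+ 2)).
  by rewrite ltr_pM2r ?exprn_gt0// /n ltrDl.
by rewrite ler_wpM2l ?(ltW n0)// ler_peMl ?sqr_ge0// /n lerDr.
Unshelve. all: by end_near.
Qed.

Lemma measurable_nu d (T : measurableType d) (p : nat) (f : T -> mxR R 1 p)
    (a : 'rV[R]_p) :
  measurable_fun setT f -> measurable_fun setT (fun w => nu (f w : 'rV[R]_p) a).
Proof.
move=> /measurable_mxRP mf.
apply: (@measurableT_comp _ _ _ _ _ _ (@Num.sqrt R)).
  by apply: continuous_measurable_fun; exact: sqrt_continuous.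
do 2 apply: measurable_sum => ?; apply: measurable_funX.
under eq_fun do rewrite !mxE.
exact: measurable_funB.
Qed.

End parameter_metric.

(** * Pointwise limits and Lipschitz coefficients of Q_G *)

Section criterion_limits.
Context (R : realType) (dO : measure_display) (Om : measurableType dO)
  (P : probability Om R) (dE : measure_display) (E : measurableType dE)
  (d L p q : nat) (M : gee_array R Om E d L p q)
  (Theta : set 'rV[R]_p) (Gamma : set 'rV[R]_q).

Lemma M_ge0 G : 0 <= M_ M G.
Proof. by apply/bigmax_geP; left. Qed.

Lemma criterionE G theta gamma w :
  Q_ M G theta gamma w = G%:R^-1 * \sum_(g < G) q_g M g theta gamma w / M_ M G.
Proof. by rewrite /Q_ -mulr_suml invfM; ring. Qed.

Lemma criterion_limit (psi : nat -> R) (tau : R) (ahat : nat -> R)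
    Qinf Sinf theta0 gamma0 theta gamma :
  (0 < L)%N ->
  sampling_scheme M -> working_covariance M Theta Gamma ->
  true_parameter P M Theta Gamma Qinf Sinf theta0 gamma0 -> A1 M ->
  A2 P M psi tau ahat -> A4 P M Theta Gamma -> A5 P M Theta Gamma ->
  Theta theta -> Gamma gamma ->
  forall e : R, 0 < e -> \forall G \near \oo,
    L1_le P (fun w => Q_ M G theta gamma w - Qinf theta gamma) e.
Proof.
move=> L0 samp wc [Qlim _ _ _ _] hA1 hA2 hA4 hA5 Tt Gg e e0.
have e4 : 0 < e / 4 by rewrite divr_gt0.
have wl := contributions_weak_law L0 samp wc hA1 hA2 hA4 hA5 Tt Gg e4.
have /fine_cvgP[_ /cvgrPdist_le/(_ _ e4) EQ] := Qlim _ _ Tt Gg.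
near=> G.
pose c := G%:R^-1 * \sum_(g < G) \int[P]_w (q_g M g theta gamma w / M_ M G).
have h1 : L1_le P (fun w => Q_ M G theta gamma w - c) (e / 4).
  have : L1_le P (fun w => G%:R^-1 * \sum_(g < G) (q_g M g theta gamma w / M_ M G
      - \int[P]_w (q_g M g theta gamma w / M_ M G))) (e / 4) by near: G.
  congr L1_le; apply/funext => w; rewrite criterionE /c -mulrBr; congr (_ * _).
  by rewrite sumrB.
have i1 := L1_le_integrable h1.
have ic : P.-integrable setT (EFin \o cst c) by exact: finite_measure_integrable_cst.
(* Exchanging expectation and sum is avoided: integrating the L_1 bound [h1] already puts c within e
   / 4 of the expectation of Q_G. *)
have cE : `|\int[P]_w Q_ M G theta gamma w - c| <= e / 4.
  have -> : \int[P]_w Q_ M G theta gamma w = \int[P]_w (Q_ M G theta gamma w - c) + c.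
    rewrite -[X in _ = _ + X](Rintegral_prob_cst P c) -RintegralD//.
    by apply: eq_Rintegral => w _; rewrite subrK.
  by rewrite addrK; exact: L1_le_bound h1.
have Ec : `|Qinf theta gamma - \int[P]_w Q_ M G theta gamma w| <= e / 4.
  have : `|Qinf theta gamma - fine ('E_P[Q_ M G theta gamma])%E| <= e / 4 by near: G.
  by rewrite unlock.
have := L1_leD h1 (L1_le_cst P (c - Qinf theta gamma)).
under eq_fun do rewrite subrKA.
apply: L1_le_weaken; apply: (@le_trans _ _ (e / 4 + (e / 4 + e / 4))); last lra.
rewrite lerD2l distrC; apply: le_trans (ler_distD _ _ _) (lerD Ec cE).
Unshelve. all: by end_near.
Qed.

(** The coefficient is the sum of the [Bq] with the scaling of Q_G, which is the quantity bounded in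
    mean. *)
Lemma criterion_lipschitz :
  A4 P M Theta Gamma -> exists (B : nat -> Om -> R) (K : R),
    (forall G, L1_le P (B G) K) /\
    forall G w a b, (Theta `*` Gamma) a -> (Theta `*` Gamma) b ->
      `|Q_ M G a.1 a.2 w - Q_ M G b.1 b.2 w| <= B G w * nu2 a b.
Proof.
move=> [_ [Bq [mB lip B0 [K EK]]] _ _].
exists (fun G w => (M_ M G * G%:R)^-1 * \sum_(g < G) Bq G g w), `|K|.
have MG0 G : 0 <= M_ M G * G%:R by rewrite mulr_ge0// M_ge0.
split=> [G|G w a b Ka Kb]; last first.
  rewrite /Q_ -mulrBr normrM ger0_norm ?invr_ge0// -mulrA ler_wpM2l ?invr_ge0//.
  rewrite -sumrB mulr_suml; apply: le_trans (ler_norm_sum _ _ _) _.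
  by apply: ler_sum => g _; exact: lip.
have E0 g : (0 <= 'E_P[Bq G g])%E.
  by rewrite unlock; apply: integral_ge0 => w _; rewrite lee_fin.
have Efin g : 'E_P[Bq G g]%E \is a fin_num.
  rewrite ge0_fin_numE//; apply: le_lt_trans (ltry (K * (M_ M G * G%:R))).
  by apply: le_trans (EK G); rewrite (bigD1 g)//= leeDl// sume_ge0.
have LB g : L1_le P (Bq G g) (fine 'E_P[Bq G g]%E).
  split; first exact: mB.
  rewrite fineK// unlock.
  by under eq_integral => w _ do rewrite ger0_norm//.
have := L1_leZ (M_ M G * G%:R)^-1 (L1_le_sum LB).
apply: L1_le_weaken; rewrite ger0_norm ?invr_ge0//.
have : \sum_g fine ('E_P[Bq G g])%E <= `|K| * (M_ M G * G%:R).
  apply: (@le_trans _ _ (K * (M_ M G * G%:R))); last by rewrite ler_wpM2r// ler_norm.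
  rewrite -lee_fin; apply: le_trans (EK G); rewrite -sumEFin.
  by apply: lee_sum => g _; rewrite fineK.
(* If M_G G = 0, as for G = 0, the inverse is 0 and the bound reads 0 <= |K|. *)
have [->|x0] := eqVneq (M_ M G * G%:R) 0; first by rewrite invr0 mul0r.
by move=> S; rewrite ler_pdivrMl ?(mulrC _ `|K|)// lt_def x0 MG0.
Qed.

End criterion_limits.

(** * Consistency of the estimator *)

Theorem theorem1 (R : realType)
    (dO : measure_display) (Om : measurableType dO) (P : probability Om R)
    (dE : measure_display) (E : measurableType dE)
    (d L p q : nat) (hd : (0 < d)%N) (hL : (0 < L)%N)
    (M : gee_array R Om E d L p q)
    (Theta : set 'rV[R]_p) (Gamma : set 'rV[R]_q)
    (theta0 : 'rV[R]_p) (gamma0 : 'rV[R]_q)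
    (Qinf : 'rV[R]_p -> 'rV[R]_q -> R)
    (Sinf : 'rV[R]_p -> 'rV[R]_q -> 'cV[R]_p)
    (psi : nat -> R) (tau : R) (ahat : nat -> R)
    (thetahat : nat -> {mfun Om >-> mxR R 1 p})
    (gammahat : nat -> {mfun Om >-> mxR R 1 q}) :
  sampling_scheme M ->
  correctly_specified P M theta0 ->
  working_covariance M Theta Gamma ->
  true_parameter P M Theta Gamma Qinf Sinf theta0 gamma0 ->
  A1 M -> A2 P M psi tau ahat -> A3 Theta Gamma -> A4 P M Theta Gamma ->
  A5 P M Theta Gamma -> A6 P M tau ahat -> A7 P M Theta Gamma ->
  A8 P M Theta Gamma theta0 ->
  gee_estimator M Theta Gamma thetahat gammahat ->
  forall e : R, 0 < e ->
    (fun G => P [set w | e < nu (thetahat G w : 'rV[R]_p) theta0]) @ \oo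
      --> 0%E.
Proof.
move=> samp _ wc true hA1 hA2 hA3 hA4 hA5 _ _ _ est e e0.
have [B [K [BK Blip]]] := criterion_lipschitz hA4.
have [_ _ [Tt0 Gg0] Qmin _] := true.
pose that G w : 'rV[R]_p * 'rV[R]_q := (thetahat G w, gammahat G w).
pose V : normedModType R := ('rV[R]_p * 'rV[R]_q)%type.
(* The pair of estimators is compared with (theta0, gamma0) under [nu2]; as nu <= nu2, an event on
   the first component alone is admissible. *)
apply: (@argmin_consistency _ _ _ P V (Theta `*` Gamma) (@nu2 R p q)
  (theta0, gamma0) (fun G a w => Q_ M G a.1 a.2 w) (fun a => Qinf a.1 a.2) B K that e
  (fun G => [set w | e < nu (thetahat G w : 'rV[R]_p) theta0])) => //.
- by move=> a b; exact: l2norm_ge0.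
- by move=> a r r0; exact: nu2_near.
- move=> [theta gamma] [/= Tt Gg] r r0.
  exact: (criterion_limit hL samp wc true hA1 hA2 hA4 hA5 Tt Gg r0).
- by move=> [theta gamma] [/= Tt Gg]; exact: Qmin.
- by move=> G w; have [] := est G w.
- by move=> G w; have [_ _ min] := est G w; exact: min.
- move=> G; have := measurable_nu theta0 (measurable_funPT (thetahat G)).
  move=> /(_ measurableT _ (measurable_itv `]e, +oo[)); rewrite setTI.
  by congr measurable; apply/seteqP; split => w /=; rewrite in_itv/= andbT.
- move=> G w /= /ltW ew; apply: le_trans (nu_le_nu2 _ _).
  by rewrite nuC.
Qed.
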